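(* The set of parameters $(p,t)$, $p\in(0,1)$, $t\in[p,1]$, that satisfy the minorant condition with some parameter $\alpha\in(0,1]$ includes the replica symmetric phase as well as a non-empty subset of the replica breaking phase.
   Context: **Graphons.** $\mathcal{W}$ is the set of measurable symmetric functions $f:[0,1]^2\to[0,1]$, modulo identifying $f$ and $g$ when $f(x,y)=g(\sigma x,\sigma y)$ for a measure-preserving bijection $\sigma$ of $[0,1]$ (functions equal a.e. are identified). For $f\in\mathcal{W}$: $\mathcal{T}(f)=\int\int\int f(x,y)f(y,z)f(x,z)\,dx\,dy\,dz$ (integrals over $[0,1]$), and $\mathcal{W}_t=\{f\in\mathcal{W}:\mathcal{T}(f)\ge t^3\}$. **Rate function.** $I_p(u)=\frac12\left(u\log\frac up+(1-u)\log\frac{1-u}{1-p}\right)$ for $u\in[0,1]$ (with $0\log 0=0$), $\mathcal{I}_p(f)=\int_0^1\int_0^1I_p(f(x,y))\,dx\,dy$, and $\phi_p(u)=\inf\{\mathcal{I}_p(f):f\in\mathcal{W},\ \mathcal{T}(f)=u^3\}$ for $u\in[0,1]$. **Phases.** The replica symmetric phase is the set of $(p,t)$ for which $\inf_{f\in\mathcal{W}_t}\mathcal{I}_p(f)=I_p(t)$ and the infimum is uniquely attained at the constant function $t$. The replica breaking phase is the set of $(p,t)$ not in the replica symmetric phase. **Minorant condition.** $(p,t)$ satisfies the minorant condition with parameter $\alpha$ if the point $(t^{3\alpha},\phi_p(t))$ lies on the convex minorant (largest convex function lying below) of the function $x\mapsto\phi_p(x^{1/(3\alpha)})$, $x\in[0,1]$.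 *)

(* Defs.v *)
From HB Require Import structures.
From mathcomp Require Import all_boot all_order all_algebra.
From mathcomp Require Import all_classical all_reals all_analysis.

Set Implicit Arguments.
Unset Strict Implicit.
Unset Printing Implicit Defensive.

Import Order.TTheory GRing.Theory Num.Theory.
Import numFieldNormedType.Exports.

Local Open Scope classical_set_scope.
Local Open Scope ring_scope.

Section Graphons.
Variable R : realType.

Local Notation mu := (@lebesgue_measure R).

Definition unit_itv : set R := `[0, 1]%classic.
Definition unit_square : set (R * R) := unit_itv `*` unit_itv.

(* A graphon is represented by a total function on R * R of which only the
   restriction to the unit square matters; the elements of the quotient space W
   are the classes of [graphon_equiv]. *)
Definition graphon : set (R * R -> R) :=
  [set f : R * R -> R | [/\ measurable_fun unit_square f,
    (forall x y, unit_itv x -> unit_itv y -> f (x, y) = f (y, x)) &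
    (forall x y, unit_itv x -> unit_itv y -> 0 <= f (x, y) <= 1)]].

Definition measure_preserving_bij (s : R -> R) : Prop :=
  [/\ set_bij unit_itv unit_itv s,
      measurable_fun unit_itv s &
      forall A : set R, measurable A ->
        mu (unit_itv `&` s @^-1` A) = mu (unit_itv `&` A)].

Definition graphon_equiv (f g : R * R -> R) : Prop :=
  exists2 s : R -> R, measure_preserving_bij s &
    {ae (mu \x mu)%E, forall z : R * R,
       unit_square z -> f z = g (s z.1, s z.2)}.

Definition triangle_density (f : R * R -> R) : R :=
  \int[mu]_(z in unit_itv) \int[mu]_(y in unit_itv) \int[mu]_(x in unit_itv)
    (f (x, y) * f (y, z) * f (x, z)).

Definition graphon_ge (t : R) : set (R * R -> R) :=
  [set f | graphon f /\ t ^+ 3 <= triangle_density f].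

(* Since [ln 0 = 0], the convention 0 log 0 = 0 holds at u = 0 and u = 1. *)
Definition rate (p u : R) : R :=
  2^-1 * (u * ln (u / p) + (1 - u) * ln ((1 - u) / (1 - p))).

Definition rate_functional (p : R) (f : R * R -> R) : R :=
  \int[mu]_(y in unit_itv) \int[mu]_(x in unit_itv) rate p (f (x, y)).

Definition phi (p u : R) : R :=
  inf [set rate_functional p f | f in
         [set f | graphon f /\ triangle_density f = u ^+ 3]].

Definition parameters : set (R * R) :=
  [set pt | 0 < pt.1 < 1 /\ pt.1 <= pt.2 <= 1].

(* [F] attains its infimum over [W] at [f0], and only at graphons identified
   with [f0]. *)
Definition uniquely_attained_at (F : (R * R -> R) -> R)
    (W : set (R * R -> R)) (f0 : R * R -> R) : Prop :=
  [/\ W f0, F f0 = inf (F @` W) &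
      forall f, W f -> F f = inf (F @` W) -> graphon_equiv f f0].

Definition replica_symmetric : set (R * R) :=
  [set pt | let: (p, t) := pt in
    [/\ parameters (p, t),
        inf (rate_functional p @` graphon_ge t) = rate p t &
        uniquely_attained_at (rate_functional p) (graphon_ge t) (cst t)]].

Definition replica_breaking : set (R * R) :=
  parameters `\` replica_symmetric.

Definition is_convex_minorant (D : set R) (h g : R -> R) : Prop :=
  [/\ convex_function D g,
      (forall x, D x -> g x <= h x) &
      forall k : R -> R, convex_function D k ->
        (forall x, D x -> k x <= h x) -> forall x, D x -> k x <= g x].

Definition minorant_condition (p t alpha : R) : Prop :=
  exists2 g : R -> R,
    is_convex_minorant unit_itv (fun x => phi p (x `^ (3 * alpha)^-1)) g &
    g (t `^ (3 * alpha)) = phi p t.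

Definition minorant_region : set (R * R) :=
  [set pt | let: (p, t) := pt in parameters (p, t) /\
    exists2 alpha, 0 < alpha <= 1 & minorant_condition p t alpha].

End Graphons.

Arguments unit_itv R : clear implicits.
Arguments unit_square R : clear implicits.
Arguments parameters R : clear implicits.
Arguments replica_symmetric R : clear implicits.
Arguments replica_breaking R : clear implicits.
Arguments minorant_region R : clear implicits.

(* Main.v *)
Require Import Defs.
From HB Require Import structures.
From mathcomp Require Import all_boot all_order all_algebra.
From mathcomp Require Import all_classical all_reals all_analysis.
From mathcomp Require Import measurable_realfun.
From mathcomp Require Import ring lra.

(** Throughout, a point lies on the convex minorant of a function as soon as
some convex function below it touches it there: the convex minorant is the
pointwise supremum of the convex functions below
([convex_minorant_touch]).  So each half of the theorem amounts to producing a
touching convex function.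

Replica symmetric points.  Let (p,t) be replica symmetric with t < 1.  Give a
thin strip of width eps of the constant graphon t the value r, and change t
elsewhere to t + eps e so that the triangle density stays at least t^3.  This
must not decrease the rate functional; to first order in eps this says
that the rate function lies above the parabola in r which touches it at t,

    rate t + rate'(t) / (2 t) * (r^2 - t^2) <= rate r

([replica_symmetric_parabola]).  A lower bound A + m r^2 on the rate function
integrates to A + m u^2 <= phi p u, because a graphon of triangle density u^3
has squared L2 norm at least u^2 ([triangle_density_L2]).  Hence phi touches
that parabola at t; in the variable x = u^2, which is alpha = 2/3, the
parabola is a line.  At t = 1 the point sits above an endpoint of the
interval, where every nonnegative function is touched by a convex function
that vanishes on the rest of the interval ([convex_endpoint]).

A replica breaking point.  Take p = 1/10.  The rate function is then
the sum of (ln 3) u^2, a constant and the function [well], a double well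
symmetric about 1/2 with its two minima at 1/4 and 3/4 ([rate_well]).  So,
for some constant L, the parabola L + (ln 3) u^2 touches the rate function
from below exactly at 1/4 and 3/4.  No t strictly between is replica
symmetric: a parabola A + m u^2 through (t, rate t) lies above the rate
function at 1/4 if m <= ln 3 and at 3/4 if m >= ln 3.  On the other
hand, phi is continuous on the open unit interval ([phi_continuous]), so
phi(u) - (ln 3) u has a minimum over [1/4, 3/4] at some t.  The chord of the
parabola between 1/4 and 3/4 has slope ln 3; it lies below the parabola, hence
below phi, outside ]1/4, 3/4[, and strictly above the rate function, hence
above phi, at 1/2.  So the minimum is attained inside, it is global on
[0,1], and the line of slope ln 3 through (t, phi t) touches phi from below.
This is the minorant condition with alpha = 1/3. *)

Set Implicit Arguments.
Unset Strict Implicit.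
Unset Printing Implicit Defensive.

Import Order.TTheory GRing.Theory Num.Theory.
Import numFieldNormedType.Exports.

Local Open Scope classical_set_scope.
Local Open Scope ring_scope.

(** * Integrals of bounded functions over the unit interval *)

Section BoundedMeasurable.
Context {R : realType}.
Local Notation mu := (@lebesgue_measure R).
Local Notation I := (unit_itv R).

Definition bounded_measurable d (Y : measurableType d) (B : set Y)
    (F : Y -> R) : Prop :=
  measurable_fun B F /\ exists M, forall y, B y -> `|F y| <= M.

Section Closure.
Context d (Y : measurableType d) (B : set Y).
Implicit Types F G : Y -> R.

Lemma bounded_measurable_cst (c : R) : bounded_measurable B (cst c).
Proof. by split; [exact: measurable_cst|exists `|c|]. Qed.

Lemma bounded_measurableD F G : bounded_measurable B F ->
  bounded_measurable B G -> bounded_measurable B (fun y => F y + G y).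
Proof.
move=> [mF [M FM]] [mG [N GN]]; split; first exact: measurable_funD.
exists (M + N) => y By; apply: le_trans (ler_normD _ _) _.
by apply: lerD; [exact: FM|exact: GN].
Qed.

Lemma bounded_measurableM F G : bounded_measurable B F ->
  bounded_measurable B G -> bounded_measurable B (fun y => F y * G y).
Proof.
move=> [mF [M FM]] [mG [N GN]]; split; first exact: measurable_funM.
exists (M * N) => y By; rewrite normrM.
by apply: ler_pM => //; [exact: FM|exact: GN].
Qed.

Lemma bounded_measurable_affine a b F : bounded_measurable B F ->
  bounded_measurable B (fun y => a * F y + b).
Proof.
move=> bF; apply: bounded_measurableD; last exact: bounded_measurable_cst.
by apply: bounded_measurableM => //; exact: bounded_measurable_cst.
Qed.

Lemma bounded_measurable_comp d' (Z : measurableType d') (C : set Z)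
    (F : Y -> R) (h : Z -> Y) :
  measurable B -> measurable_fun setT h -> (forall z, C z -> B (h z)) ->
  bounded_measurable B F -> bounded_measurable C (F \o h).
Proof.
move=> mB mh hCB [mF [M FM]]; split; last first.
  by exists M => z Cz; apply: FM; exact: hCB.
apply: (measurable_comp mB) => //; last exact: measurable_funTS.
by move=> _ [z Cz <-]; exact: hCB.
Qed.

End Closure.

Lemma measurable_unit_itv : measurable I.
Proof. exact: measurable_itv. Qed.

Lemma measure_unit_itv : mu I = 1%E.
Proof.
by rewrite /unit_itv lebesgue_measure_itv/= lte_fin ltr01 oppr0 adde0.
Qed.

Lemma bounded_measurable_integrable (g : R -> R) :
  bounded_measurable I g -> mu.-integrable I (EFin \o g).
Proof.
move=> [mg [M gM]]; apply: measurable_bounded_integrable => //.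
- exact: measurable_unit_itv.
- have fin : (mu I < +oo)%E by rewrite measure_unit_itv ltry.
  exact: fin.
- exists M; split; first exact: num_real.
  by move=> N MN x Ix; apply: le_trans (ltW MN); exact: gM.
Qed.

Lemma Rintegral_unit_cst (b : R) : \int[mu]_(x in I) b = b.
Proof.
have mI := measurable_unit_itv; have fin : fine (mu I) = 1 by rewrite measure_unit_itv.
by rewrite [LHS]Rintegral_cst// fin mulr1.
Qed.

Lemma Rintegral_unit_affine (g : R -> R) a b : bounded_measurable I g ->
  \int[mu]_(x in I) (a * g x + b) = a * (\int[mu]_(x in I) g x) + b.
Proof.
move=> bg.
have mI := measurable_unit_itv.
rewrite RintegralD//.
- rewrite RintegralZl//; last exact: bounded_measurable_integrable.
  by rewrite Rintegral_unit_cst.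
- apply: bounded_measurable_integrable.
  by apply: bounded_measurableM => //; exact: bounded_measurable_cst.
- by apply: bounded_measurable_integrable; exact: bounded_measurable_cst.
Qed.

Lemma Rintegral_unitD (g h : R -> R) :
  bounded_measurable I g -> bounded_measurable I h ->
  \int[mu]_(x in I) (g x + h x) =
  \int[mu]_(x in I) g x + \int[mu]_(x in I) h x.
Proof.
move=> bg bh; apply: RintegralD; first exact: measurable_unit_itv.
  exact: bounded_measurable_integrable.
exact: bounded_measurable_integrable.
Qed.

Lemma le_Rintegral_unit (g h : R -> R) :
  bounded_measurable I g -> bounded_measurable I h ->
  (forall x, I x -> g x <= h x) ->
  \int[mu]_(x in I) g x <= \int[mu]_(x in I) h x.
Proof.
move=> bg bh gh; apply: le_Rintegral => //; first exact: measurable_unit_itv.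
  exact: bounded_measurable_integrable.
exact: bounded_measurable_integrable.
Qed.

Lemma eq_Rintegral_unit (g h : R -> R) : (forall x, I x -> g x = h x) ->
  \int[mu]_(x in I) g x = \int[mu]_(x in I) h x.
Proof. by move=> gh; apply: eq_Rintegral => x /set_mem; exact: gh. Qed.


Section Slice.
Context d (Y : measurableType d) (B : set Y) (mB : measurable B).
Implicit Types F G : R * Y -> R.

Definition slice_int F : Y -> R := fun y => \int[mu]_(x in I) F (x, y).

Lemma bounded_measurable_section F y : bounded_measurable (I `*` B) F -> B y ->
  bounded_measurable I (fun x => F (x, y)).
Proof.
move=> bF By; apply: (bounded_measurable_comp (B := I `*` B) (h := fun x => (x, y))) => //.
by apply: measurableX => //; exact: measurable_unit_itv.
Qed.

(** Tonelli's theorem, applied to the extension of [F] by zero. *)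
Lemma slice_int_ge0_measurable F : bounded_measurable (I `*` B) F ->
  (forall z, (I `*` B) z -> 0 <= F z) -> measurable_fun B (slice_int F).
Proof.
move=> [mF [M FM]] F0.
have mIB : measurable (I `*` B).
  by apply: measurableX => //; exact: measurable_unit_itv.
pose F' := F \_ (I `*` B).
have mF' : measurable_fun setT (EFin \o F').
  by apply/measurable_EFinP; apply/(measurable_restrictT _ mIB).
have F'0 z : (0 <= (EFin \o F') z)%E.
  rewrite /= lee_fin /F' patchE; case: ifPn => // /set_mem; exact: F0.
have mG := measurable_fun_fubini_tonelli_G (m1 := mu) _ mF' F'0.
have mf : measurable_fun B (fine \o fubini_G mu (EFin \o F')).
  by apply: measurableT_comp => //; exact: measurable_funTS.
apply: eq_measurable_fun mf => y /set_mem By.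
rewrite /slice_int /= /fubini_G Rintegral_mkcond /Rintegral.
congr fine; apply: eq_integral => x _.
rewrite /= /F' !patchE; congr EFin.
have [Ix|nIx] := boolP (x \in I).
  by rewrite mem_set//; split => //; exact: set_mem.
by rewrite memNset//= => -[/= Ix _]; rewrite mem_set in nIx.
Qed.

(** Adding a bound of [F] reduces measurability to the nonnegative case. *)
Lemma bounded_measurable_slice_int F : bounded_measurable (I `*` B) F ->
  bounded_measurable B (slice_int F).
Proof.
move=> bF; have [mF [M FM]] := bF.
have sliceE y c : B y -> slice_int (fun z => F z + c) y = slice_int F y + c.
  move=> By; have := Rintegral_unit_affine 1 c (bounded_measurable_section bF By).
  by rewrite mul1r => <-; apply: eq_Rintegral_unit => x _; rewrite mul1r.
split.
  have bFM : bounded_measurable (I `*` B) (fun z => F z + M).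
    exact: bounded_measurableD (bounded_measurable_cst _ _).
  have mFM : measurable_fun B (slice_int (fun z => F z + M)).
    apply: slice_int_ge0_measurable => // z IBz.
    by rewrite -lerBlDr sub0r; have := FM z IBz; rewrite ler_norml => /andP[].
  have mm : measurable_fun B (fun y => slice_int (fun z => F z + M) y + - M).
    by apply: measurable_funD => //; exact: measurable_cst.
  apply: eq_measurable_fun mm => y /set_mem By.
  by rewrite sliceE// addrK.
exists M => y By; rewrite ler_norml; apply/andP; split.
  rewrite -[X in X <= _]Rintegral_unit_cst; apply: le_Rintegral_unit.
  - exact: bounded_measurable_cst.
  - exact: bounded_measurable_section bF By.
  - by move=> x Ix; have /(_ (conj Ix By)) := FM (x, y); rewrite ler_norml => /andP[].
rewrite -[X in _ <= X]Rintegral_unit_cst; apply: le_Rintegral_unit.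
- exact: bounded_measurable_section bF By.
- exact: bounded_measurable_cst.
- by move=> x Ix; have /(_ (conj Ix By)) := FM (x, y); rewrite ler_norml => /andP[].
Qed.

Lemma slice_int_affine F a b y : bounded_measurable (I `*` B) F -> B y ->
  slice_int (fun z => a * F z + b) y = a * slice_int F y + b.
Proof.
by move=> bF By; apply: Rintegral_unit_affine; exact: bounded_measurable_section bF By.
Qed.

Lemma slice_intD F G y : bounded_measurable (I `*` B) F ->
  bounded_measurable (I `*` B) G -> B y ->
  slice_int (fun z => F z + G z) y = slice_int F y + slice_int G y.
Proof.
move=> bF bG By; apply: Rintegral_unitD.
  exact: bounded_measurable_section bF By.
exact: bounded_measurable_section bG By.
Qed.

Lemma le_slice_int F G y : bounded_measurable (I `*` B) F ->
  bounded_measurable (I `*` B) G -> B y ->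
  (forall z, (I `*` B) z -> F z <= G z) -> slice_int F y <= slice_int G y.
Proof.
move=> bF bG By FG; apply: le_Rintegral_unit.
- exact: bounded_measurable_section bF By.
- exact: bounded_measurable_section bG By.
- by move=> x Ix; exact: FG.
Qed.

Lemma eq_slice_int F G y : B y -> (forall z, (I `*` B) z -> F z = G z) ->
  slice_int F y = slice_int G y.
Proof. by move=> By FG; apply: eq_Rintegral_unit => x Ix; exact: FG. Qed.

End Slice.
End BoundedMeasurable.

(** * The rate function *)

Section Rate.
Context {R : realType}.
Implicit Types p u v : R.

Definition rate_slope p u : R :=
  2^-1 * (ln (u / p) - ln ((1 - u) / (1 - p))).

Lemma ln_le_subr1 u : 0 < u -> ln u <= u - 1.
Proof.
move=> u0; have := @le_ln1Dx R (u - 1); rewrite (addrC 1) subrK; apply.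
by rewrite ltrBrDr addNr.
Qed.

(** This is ln x <= x - 1 at x = v / u; it is the source of the convexity of
the rate function, and it covers the endpoint u = 0, where there is no
derivative. *)
Lemma xlnx_tangent p u v : 0 < p -> 0 <= u -> 0 < v ->
  u * ln (v / p) + (u - v) <= u * ln (u / p).
Proof.
move=> p0; rewrite le_eqVlt => /predU1P[<- v0|u0 v0].
  by rewrite !mul0r add0r sub0r oppr_le0 ltW.
have := ln_le_subr1 (divr_gt0 v0 u0).
rewrite !ln_div ?posrE// => h.
have := ler_wpM2l (ltW u0) h.
have -> : u * (v / u - 1) = v - u by field; rewrite gt_eqF.
lra.
Qed.

Lemma rate_tangent p v u : 0 < p < 1 -> 0 < v < 1 -> 0 <= u <= 1 ->
  rate p v + rate_slope p v * (u - v) <= rate p u.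
Proof.
move=> /andP[p0 p1] /andP[v0 v1] /andP[u0 u1].
have q0 : 0 < 1 - p by lra.
have h1 := xlnx_tangent p0 u0 v0.
have h2 : (1 - u) * ln ((1 - v) / (1 - p)) + (1 - u - (1 - v)) <=
  (1 - u) * ln ((1 - u) / (1 - p)) by apply: xlnx_tangent => //; lra.
rewrite /rate /rate_slope; lra.
Qed.

Lemma rate_convex p l a b : 0 < p < 1 -> 0 <= l <= 1 -> 0 <= a <= 1 ->
  0 <= b <= 1 ->
  rate p (l * a + (1 - l) * b) <= l * rate p a + (1 - l) * rate p b.
Proof.
move=> p01 /andP[l0 l1] /andP[a0 a1] /andP[b0 b1].
move: l0; rewrite le_eqVlt => /predU1P[<-|l0].
  by rewrite subr0 !mul1r !mul0r !add0r.
move: l1; rewrite le_eqVlt => /predU1P[->|l1].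
  by rewrite subrr !mul1r !mul0r !addr0.
set v := l * a + (1 - l) * b.
have m0 : 0 < 1 - l by lra.
have la0 : 0 <= l * a by rewrite mulr_ge0// ltW.
have mb0 : 0 <= (1 - l) * b by rewrite mulr_ge0// ltW.
have la1 : 0 <= l * (1 - a) by rewrite mulr_ge0 ?subr_ge0// ltW.
have mb1 : 0 <= (1 - l) * (1 - b) by rewrite mulr_ge0 ?subr_ge0// ltW.
have [v0|v0] := eqVneq v 0.
  have a_0 : a = 0.
    by apply: (mulfI (lt0r_neq0 l0)); move: v0; rewrite /v; lra.
  have b_0 : b = 0.
    by apply: (mulfI (lt0r_neq0 m0)); move: v0; rewrite /v; lra.
  rewrite v0 a_0 b_0; lra.
have [v1|v1] := eqVneq v 1.
  have a_1 : 1 - a = 0.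
    by apply: (mulfI (lt0r_neq0 l0)); move: v1; rewrite /v; lra.
  have b_1 : 1 - b = 0.
    by apply: (mulfI (lt0r_neq0 m0)); move: v1; rewrite /v; lra.
  have -> : a = 1 by lra.
  have -> : b = 1 by lra.
  rewrite v1; lra.
have v01 : 0 < v < 1.
  rewrite !lt_neqAle v1 eq_sym v0 /=; apply/andP; split.
    by rewrite /v addr_ge0.
  by rewrite /v; lra.
have := rate_tangent p01 v01 (u := a); rewrite a0 a1 => /(_ isT) ha.
have := rate_tangent p01 v01 (u := b); rewrite b0 b1 => /(_ isT) hb.
have := ler_wpM2l (ltW l0) ha; have := ler_wpM2l (ltW m0) hb.
rewrite -/v.
have -> : v = l * a + (1 - l) * b by [].
set w := l * a + (1 - l) * b; set S := rate_slope _ _.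
have : l * (S * (a - w)) + (1 - l) * (S * (b - w)) = 0 by rewrite /w; ring.
lra.
Qed.

Lemma rate_slope_self p : 0 < p < 1 -> rate_slope p p = 0.
Proof.
move=> /andP[p0 p1]; rewrite /rate_slope !divff; [by rewrite subrr mulr0|lra|lra].
Qed.

Lemma rate_self p : 0 < p < 1 -> rate p p = 0.
Proof.
move=> /andP[p0 p1]; rewrite /rate !divff; [|lra|lra].
by rewrite ln1 !mulr0 addr0 mulr0.
Qed.

Lemma rate_ge0 p u : 0 < p < 1 -> 0 <= u <= 1 -> 0 <= rate p u.
Proof.
move=> p01 u01; have := rate_tangent p01 p01 u01.
by rewrite rate_self// rate_slope_self// mul0r addr0.
Qed.

Lemma rate_le p u : 0 < p < 1 -> 0 <= u <= 1 -> rate p u <= rate p 0 + rate p 1.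
Proof.
move=> p01 u01; have /andP[u0 u1] := u01.
have l01 : (0 : R) <= (1 : R) <= 1 by rewrite lexx ler01.
have l00 : (0 : R) <= (0 : R) <= 1 by rewrite lexx ler01.
have := rate_convex p01 u01 l01 l00.
rewrite mulr1 mulr0 addr0 => /le_trans; apply.
have r0 := rate_ge0 p01 l00; have r1 := rate_ge0 p01 l01.
rewrite addrC; apply: lerD; first by apply: ler_piMl => //; lra.
exact: ler_piMl.
Qed.

Lemma rate_slope_ge0 p u : 0 < p < 1 -> p <= u < 1 -> 0 <= rate_slope p u.
Proof.
move=> /andP[p0 p1] /andP[pu u1].
rewrite /rate_slope mulr_ge0// subr_ge0 ler_ln ?posrE.
- rewrite ler_pdivrMr; last lra.
  rewrite mulrAC ler_pdivlMr//; nra.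
- by apply: divr_gt0; lra.
- by apply: divr_gt0; lra.
Qed.

Lemma measurable_rate p : measurable_fun setT (rate p).
Proof.
have maff (a b : R) : measurable_fun setT (fun u : R => a * u + b).
  apply: measurable_funD; last exact: measurable_cst.
  by apply: measurable_funM => //; exact: measurable_cst.
have mxlnx c (h : R -> R) : measurable_fun setT h ->
    measurable_fun setT (fun u => h u * ln (h u / c)).
  move=> mh; apply: measurable_funM => //.
  apply: (measurableT_comp (@measurable_ln R)).
  by apply: measurable_funM => //; exact: measurable_cst.
rewrite /rate; apply: measurable_funM; first exact: measurable_cst.
apply: measurable_funD; apply: mxlnx; first exact: measurable_id.
by apply: measurable_funB => //; exact: measurable_cst.
Qed.

Lemma continuous_rate_slope p u : 0 < p < 1 -> 0 < u < 1 ->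
  {for u, continuous (rate_slope p)}.
Proof.
move=> /andP[p0 p1] /andP[u0 u1].
have cln (h : R -> R) : 0 < h u -> {for u, continuous h} ->
    {for u, continuous (fun v => ln (h v))}.
  move=> hu ch; apply: (@continuous_comp _ _ _ h (@ln R)) => //.
  exact: continuous_ln.
apply: cvgMl_tmp.
apply: cvgB; apply: cln.
- exact: divr_gt0.
- by apply: cvgMr_tmp; exact: cvg_id.
- by apply: divr_gt0; lra.
- by apply: cvgMr_tmp; apply: cvgB; [exact: cvg_cst|exact: cvg_id].
Qed.

End Rate.

(** * Triangle density and rate functional of a graphon *)

Section Graphon.
Context {R : realType}.
Local Notation mu := (@lebesgue_measure R).
Local Notation I := (unit_itv R).
Local Notation unit_square := (unit_square R).
Local Notation unit_cube := (I `*` unit_square).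

Implicit Types (p u l c s : R) (f : R * R -> R).

Lemma measurable_unit_square : measurable unit_square.
Proof. by apply: measurableX; exact: measurable_unit_itv. Qed.

Definition square_int (F : R * R -> R) : R := \int[mu]_(y in I) slice_int F y.

Definition cube_int (G : R * (R * R) -> R) : R := square_int (slice_int G).

Section SquareInt.
Implicit Types F G : R * R -> R.

Lemma square_int_affine F a b : bounded_measurable unit_square F ->
  square_int (fun z => a * F z + b) = a * square_int F + b.
Proof.
move=> bF; rewrite -Rintegral_unit_affine.
  apply: eq_Rintegral_unit => y Iy.
  exact: (slice_int_affine (@measurable_unit_itv R) a b bF Iy).
exact: (bounded_measurable_slice_int (@measurable_unit_itv R) bF).
Qed.

Lemma square_intD F G : bounded_measurable unit_square F ->
  bounded_measurable unit_square G ->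
  square_int (fun z => F z + G z) = square_int F + square_int G.
Proof.
move=> bF bG; rewrite -Rintegral_unitD.
- by apply: eq_Rintegral_unit => y Iy; exact: (slice_intD measurable_unit_itv bF bG Iy).
- exact: (bounded_measurable_slice_int (@measurable_unit_itv R) bF).
- exact: (bounded_measurable_slice_int (@measurable_unit_itv R) bG).
Qed.

Lemma le_square_int F G : bounded_measurable unit_square F ->
  bounded_measurable unit_square G ->
  (forall z, unit_square z -> F z <= G z) -> square_int F <= square_int G.
Proof.
move=> bF bG FG; apply: le_Rintegral_unit.
- exact: (bounded_measurable_slice_int (@measurable_unit_itv R) bF).
- exact: (bounded_measurable_slice_int (@measurable_unit_itv R) bG).
- by move=> y Iy; exact: (le_slice_int (@measurable_unit_itv R) bF bG Iy FG).
Qed.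

Lemma eq_square_int F G : (forall z, unit_square z -> F z = G z) ->
  square_int F = square_int G.
Proof.
by move=> FG; apply: eq_Rintegral_unit => y Iy; exact: (eq_slice_int Iy FG).
Qed.

End SquareInt.

Section CubeInt.
Implicit Types F G : R * (R * R) -> R.

Lemma cube_int_affine F a b : bounded_measurable unit_cube F ->
  cube_int (fun w => a * F w + b) = a * cube_int F + b.
Proof.
move=> bF; rewrite -square_int_affine.
  by apply: eq_square_int => z Sz; exact: (slice_int_affine measurable_unit_square a b bF Sz).
exact: (bounded_measurable_slice_int measurable_unit_square bF).
Qed.

Lemma le_cube_int F G : bounded_measurable unit_cube F ->
  bounded_measurable unit_cube G ->
  (forall w, unit_cube w -> F w <= G w) -> cube_int F <= cube_int G.
Proof.
move=> bF bG FG; apply: le_square_int.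
- exact: (bounded_measurable_slice_int measurable_unit_square bF).
- exact: (bounded_measurable_slice_int measurable_unit_square bG).
- by move=> z Sz; exact: (le_slice_int measurable_unit_square bF bG Sz FG).
Qed.

Lemma eq_cube_int F G : (forall w, unit_cube w -> F w = G w) ->
  cube_int F = cube_int G.
Proof.
by move=> FG; apply: eq_square_int => z Sz; exact: (eq_slice_int Sz FG).
Qed.

End CubeInt.

(** The components of [w] are the vertices x, y and z, nested in the order of
the iterated integrals that define [triangle_density]. *)
Definition triangle_weight (f : R * R -> R) (w : R * (R * R)) : R :=
  f (w.1, w.2.1) * f w.2 * f (w.1, w.2.2).

Lemma triangle_densityE f : triangle_density f = cube_int (triangle_weight f).
Proof.
by [].
Qed.

Lemma bounded_measurable_graphon f : graphon f ->
  bounded_measurable unit_square f.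
Proof.
move=> [mf _ f01]; split => //; exists 1 => -[x y] [Ix Iy] /=.
by have /andP[f0 f1] := f01 _ _ Ix Iy; rewrite ger0_norm.
Qed.

Lemma graphon_bounds f z : graphon f -> unit_square z -> 0 <= f z <= 1.
Proof. by case: z => x y [_ _ f01] [Ix Iy]; exact: f01. Qed.

Lemma bounded_measurable_triangle f : bounded_measurable unit_square f ->
  bounded_measurable unit_cube (triangle_weight f).
Proof.
move=> bf; have mS := measurable_unit_square.
have bh (h : R * (R * R) -> R * R) : measurable_fun setT h ->
    (forall w, unit_cube w -> unit_square (h w)) ->
    bounded_measurable unit_cube (f \o h).
  by move=> mh hS; apply: bounded_measurable_comp bf.
apply: bounded_measurableM; [apply: bounded_measurableM|].
- apply: (bh (fun w => (w.1, w.2.1))); last by move=> w [? []].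
  apply: measurable_fun_pair; first exact: measurable_fst.
  apply: (measurableT_comp measurable_fst); exact: measurable_snd.
- by apply: (bh snd); [exact: measurable_snd|move=> w []].
- apply: (bh (fun w => (w.1, w.2.2))); last by move=> w [? []].
  apply: measurable_fun_pair; first exact: measurable_fst.
  apply: (measurableT_comp measurable_snd); exact: measurable_snd.
Qed.

Lemma bounded_measurable_rate p f : 0 < p < 1 -> graphon f ->
  bounded_measurable unit_square (fun z => rate p (f z)).
Proof.
move=> p01 gf; split.
  apply: (measurableT_comp (@measurable_rate R p)); by case: gf.
exists (rate p 0 + rate p 1) => z Sz; have f01 := graphon_bounds gf Sz.
by rewrite ger0_norm ?rate_ge0//; exact: rate_le.
Qed.

Lemma rate_functionalE p f :
  rate_functional p f = square_int (fun z => rate p (f z)).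
Proof. by []. Qed.

Lemma rate_functional_ge0 p f : 0 < p < 1 -> graphon f ->
  0 <= rate_functional p f.
Proof.
move=> p01 gf; apply: Rintegral_ge0 => y Iy; apply: Rintegral_ge0 => x Ix.
by apply: rate_ge0 => //; apply: (graphon_bounds gf).
Qed.

Lemma graphon_cst u : 0 <= u <= 1 -> graphon (cst u : R * R -> R).
Proof. by move=> u01; split => //; exact: measurable_cst. Qed.

Lemma triangle_density_cst u : triangle_density (cst u : R * R -> R) = u ^+ 3.
Proof.
by rewrite /triangle_density /= !Rintegral_unit_cst -expr2 -exprSr.
Qed.

Lemma rate_functional_cst p u :
  rate_functional p (cst u : R * R -> R) = rate p u.
Proof.
by rewrite /rate_functional /= !Rintegral_unit_cst.
Qed.

(** Two such mixtures are used to correct the triangle density: with c = 0 it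
is rescaled exactly, and with c = 1 it is increased.  Convexity of the rate
function controls the cost of both. *)
Definition graphon_mix (l c : R) (f : R * R -> R) : R * R -> R :=
  fun z => l * f z + (1 - l) * c.

Lemma mix_bounds (l c a : R) : 0 <= l <= 1 -> 0 <= c <= 1 -> 0 <= a <= 1 ->
  0 <= l * a + (1 - l) * c <= 1.
Proof.
move=> /andP[l0 l1] /andP[c0 c1] /andP[a0 a1]; apply/andP; split.
  by rewrite addr_ge0// mulr_ge0// subr_ge0.
rewrite -subr_ge0.
have -> : 1 - (l * a + (1 - l) * c) = l * (1 - a) + (1 - l) * (1 - c) by ring.
by rewrite addr_ge0// mulr_ge0// subr_ge0.
Qed.

Lemma graphon_mix_graphon l c f : 0 <= l <= 1 -> 0 <= c <= 1 -> graphon f ->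
  graphon (graphon_mix l c f).
Proof.
move=> l01 c01 [mf fC f01]; split.
- apply: measurable_funD; last exact: measurable_cst.
  by apply: measurable_funM => //; exact: measurable_cst.
- by move=> x y Ix Iy; rewrite /graphon_mix fC.
- by move=> x y Ix Iy; apply: mix_bounds => //; exact: f01.
Qed.

Lemma rate_functional_mix p l c f : 0 < p < 1 -> 0 <= l <= 1 -> 0 <= c <= 1 ->
  graphon f ->
  rate_functional p (graphon_mix l c f) <=
  l * rate_functional p f + (1 - l) * rate p c.
Proof.
move=> p01 l01 c01 gf; have br := bounded_measurable_rate p01 gf.
rewrite !rate_functionalE -(square_int_affine l _ br); apply: le_square_int.
- by apply: bounded_measurable_rate => //; exact: graphon_mix_graphon.
- exact: bounded_measurable_affine.
- by move=> z Sz; apply: rate_convex => //; exact: graphon_bounds.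
Qed.

Lemma triangle_density_scale l f : graphon f ->
  triangle_density (graphon_mix l 0 f) = l ^+ 3 * triangle_density f.
Proof.
move=> gf; rewrite !triangle_densityE.
have /bounded_measurable_triangle bt := bounded_measurable_graphon gf.
rewrite -[RHS]addr0 -(cube_int_affine (l ^+ 3) 0 bt); apply: eq_cube_int => w _.
rewrite /triangle_weight /graphon_mix; ring.
Qed.

(** Let four independent events have probabilities a, b, s and s'.  The right
side is the probability that the first or the third occurs, and the second
or the fourth; the left side is the probability that the first two both
occur or the last two both occur, which is a smaller event. *)
Lemma mul_lift_ge (a b s s' : R) : 0 <= a <= 1 -> 0 <= b <= 1 -> 0 <= s <= 1 ->
  0 <= s' <= 1 ->
  a * b + s * s' * (1 - a * b) <= (a + s * (1 - a)) * (b + s' * (1 - b)).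
Proof.
move=> /andP[a0 a1] /andP[b0 b1] /andP[s0 s1] /andP[t0 t1].
rewrite -subr_ge0.
have -> : (a + s * (1 - a)) * (b + s' * (1 - b)) - (a * b + s * s' * (1 - a * b))
  = s' * (1 - s) * (a * (1 - b)) + s * (1 - s') * (b * (1 - a)) by ring.
by rewrite addr_ge0// !mulr_ge0// subr_ge0.
Qed.

Lemma triangle_weight_lift (a b c s : R) : 0 <= a <= 1 -> 0 <= b <= 1 ->
  0 <= c <= 1 -> 0 <= s <= 1 ->
  a * b * c + s ^+ 3 * (1 - a * b * c) <=
  (a + s * (1 - a)) * (b + s * (1 - b)) * (c + s * (1 - c)) <=
  a * b * c + 3 * s.
Proof.
move=> a01 b01 c01 s01.
have lift u : 0 <= u <= 1 -> 0 <= u + s * (1 - u) <= 1 /\ u + s * (1 - u) <= u + s.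
  move=> /andP[u0 u1]; have /andP[s0 s1] := s01.
  have su0 : 0 <= s * u by rewrite mulr_ge0.
  have su1 : 0 <= s * (1 - u) by rewrite mulr_ge0// subr_ge0.
  have su2 : 0 <= (1 - s) * (1 - u) by rewrite mulr_ge0// subr_ge0.
  split; last lra.
  by apply/andP; split; lra.
have ab01 : 0 <= a * b <= 1.
  by case/andP: a01 => a0 a1; case/andP: b01 => b0 b1; rewrite mulr_ge0 ?mulr_ile1.
have ss01 : 0 <= s * s <= 1.
  by case/andP: s01 => s0 s1; rewrite mulr_ge0 ?mulr_ile1.
have [] := lift a a01; have [] := lift b b01; have [] := lift c c01.
have h1 := mul_lift_ge a01 b01 s01 s01; have h2 := mul_lift_ge ab01 c01 ss01 s01.
move: h1 h2.
set a' := a + _; set b' := b + _; set c' := c + _ => h1 h2.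
move=> /andP[c'0 c'1] c's /andP[b'0 b'1] b's /andP[a'0 a'1] a's.
case/andP: a01 => a0 a1; case/andP: b01 => b0 b1; case/andP: c01 => c0 c1.
case/andP: s01 => s0 s1.
apply/andP; split.
  have -> : s ^+ 3 = s * s * s by ring.
  by apply: (le_trans h2); apply: ler_wpM2r.
have k1 : a' * b' * c' <= a * b' * c' + s.
  have : 0 <= (a + s - a') * (b' * c') by rewrite !mulr_ge0 ?subr_ge0.
  have : 0 <= s * (1 - b' * c') by rewrite mulr_ge0 ?subr_ge0 ?mulr_ile1.
  lra.
have k2 : a * b' * c' <= a * b * c' + s.
  have : 0 <= (b + s - b') * (a * c') by rewrite !mulr_ge0 ?subr_ge0.
  have : 0 <= s * (1 - a * c') by rewrite mulr_ge0 ?subr_ge0 ?mulr_ile1.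
  lra.
have k3 : a * b * c' <= a * b * c + s.
  have : 0 <= (c + s - c') * (a * b) by rewrite !mulr_ge0 ?subr_ge0.
  have : 0 <= s * (1 - a * b) by rewrite mulr_ge0 ?subr_ge0 ?mulr_ile1.
  lra.
lra.
Qed.

(** Mixing with 1 increases the density by an amount that depends on the
density only, and not on the graphon: this is what makes the continuity
estimates of phi uniform. *)
Lemma triangle_density_lift s f : 0 <= s <= 1 -> graphon f ->
  triangle_density f + s ^+ 3 * (1 - triangle_density f) <=
  triangle_density (graphon_mix (1 - s) 1 f) <= triangle_density f + 3 * s.
Proof.
move=> s01 gf; have s01' : 0 <= 1 - s <= 1.
  by case/andP: s01 => s0 s1; rewrite subr_ge0 s1 gerBl.
have g' : graphon (graphon_mix (1 - s) 1 f).
  by apply: graphon_mix_graphon => //; rewrite ler01 lexx.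
have /bounded_measurable_triangle bt := bounded_measurable_graphon gf.
have /bounded_measurable_triangle bt' := bounded_measurable_graphon g'.
have baff a b : bounded_measurable unit_cube (fun w => a * triangle_weight f w + b).
  exact: bounded_measurable_affine.
have key w : unit_cube w ->
    (1 - s ^+ 3) * triangle_weight f w + s ^+ 3 <=
    triangle_weight (graphon_mix (1 - s) 1 f) w <=
    1 * triangle_weight f w + 3 * s.
  move=> [Ix [Iy Iz]].
  have := @triangle_weight_lift (f (w.1, w.2.1)) (f w.2) (f (w.1, w.2.2)) s.
  rewrite !(graphon_bounds gf)//; move=> /(_ isT isT isT s01).
  have E a : (1 - s) * a + (1 - (1 - s)) * 1 = a + s * (1 - a) by ring.
  rewrite /triangle_weight /graphon_mix !E mul1r.
  by move=> /andP[h1 h2]; apply/andP; split => //; apply: le_trans h1; lra.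
rewrite !triangle_densityE; apply/andP; split.
  have -> : cube_int (triangle_weight f) +
      s ^+ 3 * (1 - cube_int (triangle_weight f)) =
      (1 - s ^+ 3) * cube_int (triangle_weight f) + s ^+ 3 by ring.
  rewrite -(cube_int_affine _ _ bt); apply: le_cube_int => // w Cw.
  by have /andP[] := key w Cw.
rewrite -[X in _ <= X + _]mul1r -(cube_int_affine _ _ bt); apply: le_cube_int => // w Cw.
by have /andP[] := key w Cw.
Qed.

(** Optimization over s of the inequality 2 x y <= s x^2 + y^2 / s.  The choice
s = A / u, in place of the optimal one, avoids square roots; for A = 0 let s
tend to 0. *)
Lemma young_slice (i N A u : R) : 0 < u -> 0 <= N -> 0 <= A ->
  (forall s, 0 < s -> 2 * i <= s * N + A ^+ 2 / s) ->
  2 * i <= A * (N / u + u).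
Proof.
move=> u0 N0; rewrite le_eqVlt => /predU1P[<- h|A0 h].
  rewrite mul0r leNgt; apply/negP => i0.
  have s0 : 0 < i / (N + 1) by apply: divr_gt0; lra.
  have := h _ s0; rewrite expr0n /= mul0r addr0.
  have -> : i / (N + 1) * N = i - i / (N + 1) by field; lra.
  lra.
have := h _ (divr_gt0 A0 u0).
have -> : A ^+ 2 / (A / u) = A * u by field; rewrite !gt_eqF.
have -> : A / u * N + A * u = A * (N / u + u) by ring.
by [].
Qed.

(** For a fixed vertex z, the integral over the two others is at most
||f|| A(z), with A(z) the squared norm of f(., z), by the Cauchy-Schwarz
inequality on the square.  Integrating over z gives T(f) <= ||f||^3.  The
proof uses Young's inequality instead, which linearizes this bound around
||f|| = u. *)
Lemma triangle_density_L2 f u : graphon f -> 0 < u ->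
  triangle_density f = u ^+ 3 -> u ^+ 2 <= square_int (fun z => f z ^+ 2).
Proof.
move=> gf u0 Tf.
have bf := bounded_measurable_graphon gf.
have mI := @measurable_unit_itv R.
have bf2 : bounded_measurable unit_square (fun z => f z ^+ 2).
  exact: bounded_measurableM.
pose A z := slice_int (fun z => f z ^+ 2) z.
have bA : bounded_measurable I A by exact: (bounded_measurable_slice_int mI bf2).
pose i z := \int[mu]_(y in I) \int[mu]_(x in I) (f (x, y) * f (y, z) * f (x, z)).
have bi : bounded_measurable I i.
  have /bounded_measurable_triangle bt := bf.
  have := bounded_measurable_slice_int mI
    (bounded_measurable_slice_int measurable_unit_square bt).
  by [].
set N := square_int _.
have NE : N = \int[mu]_(z in I) A z by [].
have A0 z : 0 <= A z by apply: Rintegral_ge0 => x _; exact: sqr_ge0.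
have N0 : 0 <= N by apply: Rintegral_ge0.
have TE : triangle_density f = \int[mu]_(z in I) i z by [].
have key z : I z -> 2 * i z <= A z * (N / u + u).
  move=> Iz; apply: young_slice => // s s0.
  pose g x := f (x, z).
  have bg : bounded_measurable I g by exact: (bounded_measurable_section mI bf Iz).
  have bg1 : bounded_measurable unit_square (g \o fst).
    apply: (bounded_measurable_comp mI) bg; first exact: measurable_fst.
    by move=> ? [].
  have bg2 : bounded_measurable unit_square (g \o snd).
    apply: (bounded_measurable_comp mI) bg; first exact: measurable_snd.
    by move=> ? [].
  have bgg : bounded_measurable unit_square (fun w => (g w.2 ^+ 2 * g w.1 ^+ 2)).
    by apply: bounded_measurableM; exact: bounded_measurableM.
  have ggE : square_int (fun w => (g w.2 ^+ 2 * g w.1 ^+ 2)) = A z ^+ 2.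
    transitivity (\int[mu]_(y in I) (A z * g y ^+ 2 + 0)).
      apply: eq_Rintegral_unit => y Iy.
      rewrite addr0 mulrC.
      transitivity (\int[mu]_(x in I) (g y ^+ 2 * g x ^+ 2 + 0)).
        by apply: eq_Rintegral_unit => x _; rewrite addr0.
      by rewrite Rintegral_unit_affine ?addr0//; exact: bounded_measurableM.
    by rewrite Rintegral_unit_affine ?addr0 -?expr2//; exact: bounded_measurableM.
  have iE : i z = square_int (fun w => f w * g w.2 * g w.1).
    by rewrite /i /square_int /slice_int.
  have bi' : bounded_measurable unit_square (fun w => f w * g w.2 * g w.1).
    by apply: bounded_measurableM => //; exact: bounded_measurableM.
  rewrite iE -ggE -[2 * _]addr0 -(square_int_affine 2 0 bi').
  have -> : s * N + square_int (fun w => g w.2 ^+ 2 * g w.1 ^+ 2) / s =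
      square_int (fun w => (s * f w ^+ 2 + 0) +
        (s^-1 * (g w.2 ^+ 2 * g w.1 ^+ 2) + 0)).
    rewrite square_intD; last 2 first.
    - exact: bounded_measurable_affine.
    - exact: bounded_measurable_affine.
    rewrite (square_int_affine s 0 bf2) (square_int_affine s^-1 0 bgg).
    by rewrite !addr0 [X in _ = _ + X]mulrC.
  apply: le_square_int.
  - exact: bounded_measurable_affine.
  - apply: bounded_measurableD.
      exact: bounded_measurable_affine.
    exact: bounded_measurable_affine.
  move=> w _; rewrite !addr0 -subr_ge0.
  have -> : s * f w ^+ 2 + s^-1 * (g w.2 ^+ 2 * g w.1 ^+ 2) -
      2 * (f w * g w.2 * g w.1) = s^-1 * (s * f w - g w.2 * g w.1) ^+ 2.
    by field; rewrite gt_eqF.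
  by rewrite mulr_ge0 ?sqr_ge0// invr_ge0 ltW.
have : \int[mu]_(z in I) (2 * i z + 0) <=
    \int[mu]_(z in I) ((N / u + u) * A z + 0).
  apply: le_Rintegral_unit; try exact: bounded_measurable_affine.
  by move=> z Iz; rewrite !addr0 [leRHS]mulrC; exact: key.
rewrite (Rintegral_unit_affine 2 0 bi) (Rintegral_unit_affine _ 0 bA) !addr0.
rewrite -TE Tf -NE.
move=> /(ler_wpM2l (ltW u0)).
have -> : u * ((N / u + u) * N) = N ^+ 2 + u ^+ 2 * N by field; rewrite gt_eqF.
move=> h; rewrite leNgt; apply/negP => Nu.
have : 0 < (u ^+ 2 - N) * (N + 2 * u ^+ 2).
  apply: mulr_gt0; first by rewrite subr_gt0.
  by rewrite ltr_wpDl// mulr_gt0// exprn_gt0.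
have -> : (u ^+ 2 - N) * (N + 2 * u ^+ 2) =
  2 * u ^+ 4 - (N ^+ 2 + u ^+ 2 * N) by ring.
have E : u * (2 * u ^+ 3) = 2 * u ^+ 4 by ring.
by rewrite subr_gt0 -E ltNge h.
Qed.

End Graphon.

(** * The constrained infimum phi and convex minorants *)

Section Phi.
Context {R : realType}.
Implicit Types (p u v a b s : R) (f : R * R -> R).

Lemma phi_le p u f : 0 < p < 1 -> graphon f -> triangle_density f = u ^+ 3 ->
  phi p u <= rate_functional p f.
Proof.
move=> p01 gf Tf; apply: ge_inf; last by exists f.
by exists 0 => _ [g [gg _] <-]; exact: rate_functional_ge0.
Qed.

Lemma phi_ge p u (c : R) : 0 <= u <= 1 ->
  (forall f, graphon f -> triangle_density f = u ^+ 3 ->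
    c <= rate_functional p f) -> c <= phi p u.
Proof.
move=> u01 h; apply: lb_le_inf; last by move=> _ [f [gf Tf] <-]; exact: h.
exists (rate_functional p (cst u)), (cst u) => //; split.
  exact: graphon_cst.
exact: triangle_density_cst.
Qed.

Lemma phi_ge0 p u : 0 < p < 1 -> 0 <= u <= 1 -> 0 <= phi p u.
Proof. by move=> p01 u01; apply: phi_ge => // f gf _; exact: rate_functional_ge0. Qed.

Lemma phi_le_rate p u : 0 < p < 1 -> 0 <= u <= 1 -> phi p u <= rate p u.
Proof.
move=> p01 u01; rewrite -(rate_functional_cst p u); apply: phi_le => //.
exact: triangle_density_cst.
Qed.

(** The bound on the rate function integrates to A + m ||f||^2, and ||f||^2 is
at least u^2 when the triangle density of f is u^3. *)
Lemma phi_ge_parabola p (A m : R) u : 0 < p < 1 -> 0 <= m ->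
  (forall r : R, 0 <= r <= 1 -> A + m * r ^+ 2 <= rate p r) ->
  0 <= u <= 1 -> A + m * u ^+ 2 <= phi p u.
Proof.
move=> p01 m0 Amr u01; apply: phi_ge => // f gf Tf.
have bf := bounded_measurable_graphon gf.
have bf2 : bounded_measurable (unit_square R) (fun z => f z ^+ 2).
  exact: bounded_measurableM.
apply: (@le_trans _ _ (m * square_int (fun z => f z ^+ 2) + A)).
  rewrite addrC lerD2r; apply: ler_wpM2l => //.
  have /andP[] := u01; rewrite le_eqVlt => /predU1P[<- _|u0 _].
    rewrite expr0n /=; apply: Rintegral_ge0 => y _; apply: Rintegral_ge0 => x _.
    exact: sqr_ge0.
  exact: triangle_density_L2.
rewrite -(square_int_affine m A bf2) rate_functionalE; apply: le_square_int.
- exact: bounded_measurable_affine.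
- exact: bounded_measurable_rate.
- by move=> z Sz; rewrite addrC; apply: Amr; exact: graphon_bounds.
Qed.

(** A competitor for v, multiplied by u / v, is a competitor for u. *)
Lemma phi_scale p u v : 0 < p < 1 -> 0 <= u -> u <= v -> 0 < v <= 1 ->
  phi p u <= phi p v + (1 - u / v) * rate p 0.
Proof.
move=> p01 u0 uv /andP[v0 v1]; rewrite -lerBlDr.
apply: phi_ge => [|f gf Tf]; first by rewrite (ltW v0).
have l01 : 0 <= u / v <= 1.
  by rewrite divr_ge0 ?(ltW v0)//= ler_pdivrMr// mul1r.
have c01 : (0 : R) <= (0 : R) <= 1 by rewrite lexx ler01.
rewrite lerBlDr.
apply: (@le_trans _ _ (rate_functional p (graphon_mix (u / v) 0 f))).
  apply: phi_le => //; first exact: graphon_mix_graphon.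
  by rewrite triangle_density_scale// Tf expr_div_n mulfVK// expf_neq0// gt_eqF.
apply: le_trans (rate_functional_mix p01 l01 c01 gf) _; rewrite lerD2r.
by apply: ler_piMl; [exact: rate_functional_ge0|case/andP: l01].
Qed.

Lemma cube_rescale b (tau : R) : 0 < b -> b ^+ 3 <= tau ->
  exists l : R, [/\ 0 <= l <= 1, l ^+ 3 * tau = b ^+ 3 &
    1 - l <= (tau - b ^+ 3) / b ^+ 3].
Proof.
move=> b0 tb; have b30 : 0 < b ^+ 3 by rewrite exprn_gt0.
have t0 : 0 < tau := lt_le_trans b30 tb.
have q0 : 0 <= b ^+ 3 / tau by rewrite divr_ge0// ltW.
exists ((b ^+ 3 / tau) `^ 3^-1); set l := _ `^ _.
have l3 : l ^+ 3 = b ^+ 3 / tau.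
  by rewrite -powR_mulrn ?powR_ge0// -powRrM mulVf// powRr1.
have l0 : 0 <= l by exact: powR_ge0.
have l1 : l <= 1 by rewrite -(@expr_le1 _ 3)// l3 ler_pdivrMr// mul1r.
have l3l : l ^+ 3 <= l.
  by rewrite exprS; apply: ler_piMr => //; exact: exprn_ile1.
split; [by rewrite l0|by rewrite l3 divfK// gt_eqF|].
apply: (@le_trans _ _ ((tau - b ^+ 3) / tau)).
  have -> : (tau - b ^+ 3) / tau = 1 - b ^+ 3 / tau by field; rewrite gt_eqF.
  by rewrite -l3 lerD2l lerN2.
by apply: ler_wpM2l; rewrite ?subr_ge0// lef_pV2.
Qed.

(** A competitor f for a is first mixed with 1, with weight s, to bring its
triangle density above b^3, and then multiplied by a constant l to bring
it to b^3 exactly.  Here l is close to 1, as the mixture overshoots by at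
most 3 s. *)
Lemma phi_lift p a b s : 0 < p < 1 -> 0 < a -> a <= b -> b < 1 ->
  0 <= s <= 1 -> b ^+ 3 - a ^+ 3 <= s ^+ 3 * (1 - b ^+ 3) ->
  phi p b <= phi p a + s * (rate p 1 + 3 / b ^+ 3 * rate p 0).
Proof.
move=> p01 a0 ab b1 s01 hs; have /andP[s0 s1] := s01.
have b0 : 0 < b := lt_le_trans a0 ab.
have a3b3 : a ^+ 3 <= b ^+ 3 by rewrite lerXn2r// nnegrE ltW.
have b30 : 0 < b ^+ 3 by rewrite exprn_gt0.
have lift_ge : b ^+ 3 <= a ^+ 3 + s ^+ 3 * (1 - a ^+ 3).
  have s30 : 0 <= s ^+ 3 by rewrite exprn_ge0.
  have := ler_wpM2l s30 a3b3; lra.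
have s01' : 0 <= 1 - s <= 1 by rewrite subr_ge0 s1 gerBl.
have c01 : (0 : R) <= (0 : R) <= 1 by rewrite lexx ler01.
have c11 : (0 : R) <= (1 : R) <= 1 by rewrite lexx ler01.
rewrite -lerBlDr; apply: phi_ge => [|f gf Tf].
  by rewrite ltW//= (le_trans ab)// ltW.
rewrite lerBlDr.
have g' : graphon (graphon_mix (1 - s) 1 f) by exact: graphon_mix_graphon.
have := triangle_density_lift s01 gf.
have := rate_functional_mix p01 s01' c11 gf.
set g := graphon_mix _ _ _; rewrite Tf => rg.
move tauE : (triangle_density g) => tau /andP[t1 t2].
have [l [l01 l3 l_ge]] := cube_rescale b0 (le_trans lift_ge t1).
have /andP[l0 l1] := l01.
apply: (@le_trans _ _ (rate_functional p (graphon_mix l 0 g))).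
  apply: phi_le => //; first exact: graphon_mix_graphon.
  by rewrite triangle_density_scale// tauE l3.
apply: le_trans (rate_functional_mix p01 l01 c01 g') _.
have F0 := rate_functional_ge0 p01 gf.
have G0 := rate_functional_ge0 p01 g'.
have r0 : 0 <= rate p 0 by exact: rate_ge0.
have l_ge' : 1 - l <= s * (3 / b ^+ 3).
  apply: (le_trans l_ge); rewrite mulrA ler_pM2r ?invr_gt0//.
  move: t2 a3b3; clear; lra.
apply: (@le_trans _ _ (rate_functional p g + s * (3 / b ^+ 3) * rate p 0)).
  by apply: lerD; [exact: ler_piMl|exact: ler_wpM2r].
have sF0 := mulr_ge0 s0 F0; move: rg sF0.
move: (rate_functional p f) (rate_functional p g) (rate p 0) (rate p 1).
move=> F G r0' r1; clear; lra.
Qed.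

(** [phi_scale] and [phi_lift] bound the two differences between values of phi
at neighboring points. *)
Lemma phi_continuous p u : 0 < p < 1 -> 0 < u < 1 ->
  {for u, continuous (phi p)}.
Proof.
move=> p01 /andP[u0 u1].
have c01 : (0 : R) <= (0 : R) <= 1 by rewrite lexx ler01.
have c11 : (0 : R) <= (1 : R) <= 1 by rewrite lexx ler01.
have r0 : 0 <= rate p 0 by exact: rate_ge0.
have r1 : 0 <= rate p 1 by exact: rate_ge0.
have u30 : 0 < u ^+ 3 by rewrite exprn_gt0.
apply/cvgrPdist_le => e e0 /=.
(* Of the two compared points the larger, b, is at least u: K bounds the factor
   of s in phi_lift. *)
pose K := rate p 1 + 3 / u ^+ 3 * rate p 0.
have K0 : 0 <= K by rewrite addr_ge0// mulr_ge0// divr_ge0// ltW.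
pose s := Num.min 1 (e / (K + 1)).
have s0 : 0 < s by rewrite lt_min ltr01 divr_gt0// ltr_pwDr.
have s01 : 0 <= s <= 1 by rewrite ltW//= ge_min lexx.
have sK : s * K <= e.
  apply: (@le_trans _ _ (e / (K + 1) * K)).
    by apply: ler_wpM2r => //; rewrite ge_min lexx orbT.
  rewrite mulrAC ler_pdivrMr; last lra.
  by rewrite ler_pM2l// lerDl.
have s30 : 0 < s ^+ 3 by rewrite exprn_gt0.
have two_sided a b : 0 < a -> a <= b -> u <= b -> b <= (1 + u) / 2 ->
    6 * (b - a) <= s ^+ 3 * (1 - u) -> (b - a) * (rate p 0 + 1) <= e * u ->
    `|phi p a - phi p b| <= e.
  move=> a0 ab ub bu h1 h2.
  have b1 : b < 1 by lra.
  have b0 : 0 < b by lra.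
  have b30 : 0 < b ^+ 3 by rewrite exprn_gt0.
  rewrite ler_norml; apply/andP; split.
    have hs : b ^+ 3 - a ^+ 3 <= s ^+ 3 * (1 - b ^+ 3).
      have -> : b ^+ 3 - a ^+ 3 = (b - a) * (b ^+ 2 + a * b + a ^+ 2) by ring.
      have q : b ^+ 2 + a * b + a ^+ 2 <= 3.
        have b2 : b ^+ 2 <= 1 by rewrite exprn_ile1// ltW.
        have a2 : a ^+ 2 <= 1 by rewrite exprn_ile1//; lra.
        have ab1 : a * b <= 1 by rewrite mulr_ile1//; lra.
        lra.
      have ba : 0 <= b - a by lra.
      have := ler_wpM2l ba q.
      have b31 : b ^+ 3 <= b by rewrite exprS ler_piMr ?exprn_ile1//; lra.
      have b31' : (1 - u) / 2 <= 1 - b ^+ 3 by lra.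
      have := ler_wpM2l (ltW s30) b31'.
      lra.
    have := phi_lift p01 a0 ab b1 s01 hs.
    have : 3 / b ^+ 3 <= 3 / u ^+ 3.
      by rewrite ler_pM2l// lef_pV2 ?posrE// lerXn2r// nnegrE ltW.
    move=> /(ler_wpM2r r0) k1.
    have : rate p 1 + 3 / b ^+ 3 * rate p 0 <= K by rewrite lerD2l.
    move=> /(ler_wpM2l (ltW s0)).
    lra.
  have b01 : 0 < b <= 1 by rewrite b0 ltW.
  have := phi_scale p01 (ltW a0) ab b01.
  have : (1 - a / b) * rate p 0 <= e.
    have -> : (1 - a / b) * rate p 0 = (b - a) * rate p 0 / b by field; rewrite gt_eqF.
    rewrite ler_pdivrMr//.
    have := ler_wpM2l (ltW e0) ub.
    lra.
  lra.
pose d := Num.min (Num.min (u / 2) ((1 - u) / 2))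
  (Num.min (s ^+ 3 * (1 - u) / 6) (e * u / (rate p 0 + 1))).
have r01 : 0 < rate p 0 + 1 by lra.
have d0 : 0 < d.
  rewrite !lt_min !divr_gt0// ?mulr_gt0//; lra.
near=> v.
have : `|u - v| < d by near: v; apply: cvgr_dist_lt => //; exact: cvg_id.
rewrite !lt_min => /andP[/andP[d1 d2] /andP[d3 d4]].
move: d1 d2 d3 d4; have [uv|vu] := leP u v.
  rewrite ler0_norm ?subr_le0// opprB => d1 d2.
  rewrite !ltr_pdivlMr// => d3 d4.
  apply: two_sided => //; lra.
rewrite ger0_norm ?subr_ge0 ?(ltW vu)// => d1 d2.
rewrite !ltr_pdivlMr// => d3 d4.
rewrite distrC; apply: two_sided => //; lra.
Unshelve. all: by end_near.
Qed.

End Phi.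

Section Minorant.
Context {R : realType}.

(** The convex minorant is the supremum of all convex functions below h.  The
function [k0] makes this family nonempty, which the real-valued supremum
requires. *)
Lemma convex_minorant_touch (D : set R) (h k0 : R -> R) (x0 : R) :
  convex_function D k0 -> (forall x, D x -> k0 x <= h x) ->
  D x0 -> k0 x0 = h x0 ->
  exists2 g, is_convex_minorant D h g & g x0 = h x0.
Proof.
move=> ck0 k0h Dx0 k0x0.
pose M x := [set k x | k in [set k : R -> R |
  convex_function D k /\ forall x, D x -> k x <= h x]].
have M0 x : M x !=set0 by exists (k0 x), k0.
have Mub x : D x -> ubound (M x) (h x) by move=> Dx _ [k [_ kh] <-]; exact: kh.
have geM k x : D x -> convex_function D k ->
    (forall x, D x -> k x <= h x) -> k x <= sup (M x).
  move=> Dx ck kh; apply: ub_le_sup; last by exists k.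
  by exists (h x); exact: Mub.
have leM x : D x -> sup (M x) <= h x by move=> Dx; apply: ge_sup => //; exact: Mub.
exists (fun x => sup (M x)); last first.
  by apply/eqP; rewrite eq_le leM//= -k0x0 geM.
split => [t x y /set_mem Dx /set_mem Dy|//|k ck kh x Dx]; last exact: geM.
apply: ge_sup => // _ [k [ck kh] <-].
apply: le_trans (ck t x y (mem_set Dx) (mem_set Dy)) _.
apply: lerD; apply: ler_wpM2l => //.
- exact: (geM k x Dx ck kh).
- by rewrite subr_ge0.
- exact: (geM k y Dy ck kh).
Qed.

Lemma powR_unit_itv (x r : R) : 0 <= x <= 1 -> 0 <= r -> 0 <= x `^ r <= 1.
Proof.
move=> /andP[x0 x1] r0; rewrite powR_ge0 /=.
by have := @ge0_ler_powR _ _ r0 x 1; rewrite powR1; apply; rewrite ?nnegrE.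
Qed.

(** The touching condition in the variable u, where x = u^(3 alpha). *)
Lemma minorant_condition_touch (p t alpha : R) (k0 : R -> R) :
  0 < alpha -> 0 <= t <= 1 ->
  convex_function (unit_itv R) k0 ->
  (forall u, 0 <= u <= 1 -> k0 (u `^ (3 * alpha)) <= phi p u) ->
  k0 (t `^ (3 * alpha)) = phi p t ->
  minorant_condition p t alpha.
Proof.
move=> a0 /andP[t0 t1] ck0 k0phi k0t.
have g0 : 0 < 3 * alpha by rewrite mulr_gt0.
have ht : phi p ((t `^ (3 * alpha)) `^ (3 * alpha)^-1) = phi p t.
  by rewrite -powRrM mulfV ?gt_eqF// powRr1.
rewrite /minorant_condition -ht.
apply: (convex_minorant_touch (h := fun x => phi p (x `^ (3 * alpha)^-1)) ck0).
- move=> x; rewrite /unit_itv /= in_itv /= => /andP[x0 x1].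
  have xE : (x `^ (3 * alpha)^-1) `^ (3 * alpha) = x.
    by rewrite -powRrM mulVf ?gt_eqF// powRr1.
  rewrite -[X in k0 X]xE; apply: k0phi; apply: powR_unit_itv; first by rewrite x0.
  by rewrite invr_ge0 ltW.
- rewrite /unit_itv /= in_itv /=; apply: powR_unit_itv; first by rewrite t0.
  exact: ltW.
- by rewrite k0t ht.
Qed.

Lemma convex_affine (D : set R) (a b : R) :
  convex_function D (fun x => a + b * x).
Proof.
move=> t x y _ _.
have affine (s u v : R) :
    a + b * (s * u + (1 - s) * v) = s * (a + b * u) + (1 - s) * (a + b * v).
  by ring.
by have := lexx (a + b * (t%:num * x + (1 - t%:num) * y)); rewrite {2}affine.
Qed.

(** A convex function on a closed interval may jump up at an endpoint. *)
Lemma convex_endpoint (c : R) : 0 <= c ->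
  convex_function (unit_itv R) (fun x => if x == 1 then c else 0).
Proof.
move=> c0; pose f (z : R) := if z == 1 then c else 0.
have f0 z : 0 <= f z by rewrite /f; case: ifP.
have convex_f (a x y : R) : 0 <= a -> 0 <= 1 - a -> x <= 1 -> y <= 1 ->
    f (a * x + (1 - a) * y) <= a * f x + (1 - a) * f y.
  move=> a0 a1 x1 y1; rewrite {1}/f.
  case: ifPn => [/eqP w1|_]; last by rewrite addr_ge0// mulr_ge0.
  have ax : 0 <= a * (1 - x) by rewrite mulr_ge0// subr_ge0.
  have ay : 0 <= (1 - a) * (1 - y) by rewrite mulr_ge0// subr_ge0.
  have weight (b z : R) : b * (1 - z) = 0 -> b * f z = b * c.
    move=> /eqP; rewrite mulf_eq0 => /orP[/eqP->|]; first by rewrite !mul0r.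
    by rewrite subr_eq0 eq_sym /f => ->.
  rewrite (weight a x); last lra.
  rewrite (weight (1 - a) y); last lra.
  by rewrite -mulrDl addrC subrK mul1r.
move=> t x y; rewrite !inE /unit_itv /= !in_itv /= => /andP[_ x1] /andP[_ y1].
by apply: (convex_f t%:num x y) => //; rewrite subr_ge0.
Qed.

End Minorant.

(** * Two-valued perturbations of a constant graphon *)

Section TwoBlock.
Context {R : realType}.
Local Notation mu := (@lebesgue_measure R).
Local Notation I := (unit_itv R).
Implicit Types (p t r c b e x y : R).

Definition strip_ind (eps : R) : R -> R := \1_(`[eps, 1]%classic).

(** The value is r when a coordinate lies in [0, eps[ and r + c elsewhere.  This
form, a constant plus a multiple of a product of an idempotent function with
itself, makes the triangle density computable by integrating one variable
at a time. *)
Definition strip_graphon (eps r c : R) : R * R -> R :=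
  fun z => r + c * (strip_ind eps z.1 * strip_ind eps z.2).

Lemma strip_ind_idem (eps x : R) : strip_ind eps x ^+ 2 = strip_ind eps x.
Proof.
by rewrite /strip_ind indicE; case: (_ \in _); rewrite ?expr1n ?expr0n.
Qed.

Lemma strip_ind_mul01 (eps x y : R) :
  strip_ind eps x * strip_ind eps y = 0 \/ strip_ind eps x * strip_ind eps y = 1.
Proof.
rewrite /strip_ind !indicE.
by do 2 case: (_ \in _); rewrite ?mulr1 ?mulr0 /=; [right|left|left|left].
Qed.

Lemma bounded_measurable_strip (eps : R) : bounded_measurable I (strip_ind eps).
Proof.
split.
  by apply: measurable_funTS; apply: measurable_indic; exact: measurable_itv.
exists 1 => y _; rewrite /strip_ind indicE.
by case: (_ \in _); rewrite ?normr1 ?normr0.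
Qed.

Lemma Rintegral_strip (eps : R) (a b : R) : 0 <= eps <= 1 ->
  \int[mu]_(x in I) (a * strip_ind eps x + b) = a * (1 - eps) + b.
Proof.
move=> /andP[e0 e1].
rewrite (Rintegral_unit_affine a b (bounded_measurable_strip eps)).
congr (a * _ + b).
have muE : mu `[eps, 1]%classic = (1 - eps)%:E.
  rewrite lebesgue_measure_itv /= lte_fin.
  by move: e1; rewrite le_eqVlt => /predU1P[->|->]; rewrite ?ltxx ?subrr.
rewrite /Rintegral integral_indic//; last exact: measurable_unit_itv.
rewrite (_ : _ `&` _ = `[eps, 1]%classic); first exact: (congr1 fine muE).
apply/seteqP; split => x /=; rewrite /unit_itv /= !in_itv /=; first by case.
by move=> /andP[ex x1]; split; [rewrite ex x1|rewrite (le_trans e0 ex) x1].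
Qed.

Lemma strip_graphon_graphon (eps r c : R) : 0 <= r <= 1 -> 0 <= r + c <= 1 ->
  graphon (strip_graphon eps r c).
Proof.
move=> r01 rc01; split.
- apply: measurable_funD; first exact: measurable_cst.
  apply: measurable_funM; first exact: measurable_cst.
  have mi : measurable_fun setT (strip_ind eps).
    by apply: measurable_indic; exact: measurable_itv.
  apply: measurable_funM; apply: measurable_funTS.
    exact: (measurableT_comp mi measurable_fst).
  exact: (measurableT_comp mi measurable_snd).
- by move=> x y _ _; rewrite /strip_graphon /= (mulrC (strip_ind eps x)).
- move=> x y _ _; rewrite /strip_graphon /=.
  by case: (strip_ind_mul01 eps x y) => ->; rewrite ?mulr0 ?addr0 ?mulr1.
Qed.

Lemma triangle_density_strip (eps r c : R) : 0 <= eps <= 1 ->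
  triangle_density (strip_graphon eps r c) =
  r ^+ 3 + 3 * r ^+ 2 * c * (1 - eps) ^+ 2 +
  (3 * r * c ^+ 2 + c ^+ 3) * (1 - eps) ^+ 3.
Proof.
move=> e01; pose w := 1 - eps; pose X := strip_ind eps.
have idem x : X x ^+ 2 = X x := strip_ind_idem eps x.
have int_strip a b : \int[mu]_(x in I) (a * X x + b) = a * w + b.
  exact: Rintegral_strip.
rewrite -/w; move: (w) int_strip => {}w int_strip.
have first_int y z : \int[mu]_(x in I) (strip_graphon eps r c (x, y) *
      strip_graphon eps r c (y, z) * strip_graphon eps r c (x, z)) =
    (r ^+ 2 * c * w + (3 * r * c ^+ 2 * w + r ^+ 2 * c + c ^+ 3 * w) * X z) *
      X y + (r ^+ 3 + r ^+ 2 * c * w * X z).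
  transitivity (\int[mu]_(x in I)
      ((r + c * (X y * X z)) * (r * c * (X y + X z) + c ^+ 2 * (X y * X z)) *
        X x + (r + c * (X y * X z)) * r ^+ 2)).
    apply: eq_Rintegral_unit => x _; rewrite /strip_graphon /= -/X.
    transitivity ((r + c * (X y * X z)) * (c ^+ 2 * X y * X z * X x ^+ 2 +
      r * c * (X y + X z) * X x + r ^+ 2)); first by ring.
    by rewrite idem; ring.
  rewrite int_strip.
  transitivity (r ^+ 3 + r ^+ 2 * c * w * (X y + X z) + r ^+ 2 * c * X y * X z +
    r * c ^+ 2 * w * X y * X z +
    r * c ^+ 2 * w * (X y ^+ 2 * X z + X y * X z ^+ 2) +
    c ^+ 3 * w * X y ^+ 2 * X z ^+ 2); first by ring.
  by rewrite !idem; ring.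
rewrite /triangle_density.
transitivity (\int[mu]_(z in I)
    ((r ^+ 2 * c * w + (3 * r * c ^+ 2 * w + r ^+ 2 * c + c ^+ 3 * w) * w) *
      X z + (r ^+ 3 + r ^+ 2 * c * w * w))).
  apply: eq_Rintegral_unit => z _.
  under eq_Rintegral do rewrite first_int.
  by rewrite int_strip; ring.
by rewrite int_strip; ring.
Qed.

Lemma rate_functional_strip p (eps r c : R) : 0 <= eps <= 1 ->
  rate_functional p (strip_graphon eps r c) =
  rate p r + (rate p (r + c) - rate p r) * (1 - eps) ^+ 2.
Proof.
move=> e01; pose w := 1 - eps; pose X := strip_ind eps.
have int_strip a b : \int[mu]_(x in I) (a * X x + b) = a * w + b.
  exact: Rintegral_strip.
rewrite -/w; move: (w) int_strip => {}w int_strip.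
set d := rate p (r + c) - rate p r.
transitivity (\int[mu]_(y in I) (d * w * X y + rate p r)).
  apply: eq_Rintegral_unit => y _.
  transitivity (\int[mu]_(x in I) (d * X y * X x + rate p r)).
    apply: eq_Rintegral_unit => x _; rewrite /strip_graphon /=.
    rewrite -mulrA (mulrC (X y)) /X.
    case: (strip_ind_mul01 eps x y) => ->.
      by rewrite !mulr0 addr0 add0r.
    by rewrite !mulr1 subrK.
  by rewrite int_strip mulrAC.
by rewrite int_strip -mulrA -expr2 addrC.
Qed.

Lemma replica_symmetric_le p t f : replica_symmetric R (p, t) ->
  graphon f -> t ^+ 3 <= triangle_density f -> rate p t <= rate_functional p f.
Proof.
move=> [[/= p01 _] <- _] gf Tf; apply: ge_inf; last by exists f.
by exists 0 => _ [g [gg _] <-]; exact: rate_functional_ge0.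
Qed.

(** First-order optimality of the constant t.  Take the value r on the strip and
b(x) = t + x e elsewhere, with x the width of the strip.  Then the triangle
density exceeds t^3 by x Q(x), where Q(0) > 0 is the hypothesis on e; and,
bounding the rate at b(x) by its tangent, the rate functional exceeds rate t
by at most x S(x), where S(0) is the conclusion.  If S(0) were negative, a
small x would contradict replica symmetry. *)
Lemma strip_perturbation p t r e : replica_symmetric R (p, t) -> t < 1 ->
  0 <= r <= 1 -> t ^+ 2 - r ^+ 2 < t * e ->
  0 <= 2 * (rate p r - rate p t) + rate_slope p t * e.
Proof.
move=> RS t1 r01 et.
have [[/= p01 /andP[pt _]] _ _] := RS.
have /andP[p0 p1] := p01.
have t0 : 0 < t := lt_le_trans p0 pt.
rewrite leNgt; apply/negP => neg.
pose b (x : R) := t + x * e.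
pose Q (x : R) := e * (3 * (t * t) + 3 * t * (x * e) + (x * e) * (x * e)) -
  3 * (r * r) * (b x - r) * (2 - x) -
  (3 * r * ((b x - r) * (b x - r)) + (b x - r) * ((b x - r) * (b x - r))) *
   (3 - 3 * x + x * x).
pose S (x : R) := (2 - x) * (rate p r - rate p t) +
  ((1 - x) * (1 - x)) * rate_slope p (b x) * e.
have cb : b x @[x --> (0 : R)] --> b 0.
  by apply: cvgD; [exact: cvg_cst|apply: cvgM; [exact: cvg_id|exact: cvg_cst]].
have cQ : Q x @[x --> (0 : R)] --> Q 0.
  pose B : {poly R} := t%:P + e *: 'X.
  (* As a polynomial, Q is continuous. *)
  pose q : {poly R} := e *: ((3 * (t * t))%:P + (3 * t * e) *: 'X +
      (e * e) *: ('X * 'X)) -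
    (3 * (r * r)) *: (B - r%:P) * (2%:P - 'X) -
    ((3 * r) *: ((B - r%:P) * (B - r%:P)) +
      (B - r%:P) * ((B - r%:P) * (B - r%:P))) * (3%:P - 3 *: 'X + 'X * 'X).
  have -> : Q = horner q.
    by apply/funext => x; rewrite /Q /q /B /b !hornerE /=; ring.
  exact: continuous_horner.
have b0E : b 0 = t by rewrite /b mul0r addr0.
have cS : S x @[x --> (0 : R)] --> S 0.
  rewrite /S; apply: cvgD.
    by repeat first [exact: cvg_cst | exact: cvg_id | apply: cvgB | apply: cvgM].
  apply: cvgM; last exact: cvg_cst.
  apply: cvgM.
    by repeat first [exact: cvg_cst | exact: cvg_id | apply: cvgB | apply: cvgM].
  apply: (@continuous_comp _ _ _ b (rate_slope p)) => //.
  by apply: continuous_rate_slope => //; rewrite b0E t0.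
have Q0 : 0 < Q 0.
  have -> : Q 0 = 3 * t * (t * e - (t ^+ 2 - r ^+ 2)) by rewrite /Q b0E; ring.
  by rewrite !mulr_gt0// subr_gt0.
have S0 : S 0 < 0 by rewrite /S b0E !subr0 !mul1r.
suff : \forall x \near (0 : R)^'+, False by move=> /filter_ex[].
have near_right (P : set R) : (\forall x \near (0 : R), P x) ->
    \forall x \near (0 : R)^'+, P x.
  exact: cvg_within.
near=> x.
have x0 : 0 < x by near: x; exact: nbhs_right_gt.
have x1 : x < 1 by near: x; apply: nbhs_right_lt.
have Qx : 0 < Q x by near: x; apply: near_right; exact: (cvgr_gt _ cQ).
have Sx : S x < 0 by near: x; apply: near_right; exact: (cvgr_lt _ cS).
have bx0 : 0 < b x by near: x; apply: near_right; apply: (cvgr_gt _ cb); rewrite b0E.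
have bx1 : b x < 1 by near: x; apply: near_right; apply: (cvgr_lt _ cb); rewrite b0E.
have x01 : 0 <= x <= 1 by rewrite !ltW.
have bx01 : 0 < b x < 1 by rewrite bx0.
have rbK : r + (b x - r) = b x by rewrite addrC subrK.
have gf : graphon (strip_graphon x r (b x - r)).
  by apply: strip_graphon_graphon => //; rewrite rbK !ltW.
have Tf : t ^+ 3 <= triangle_density (strip_graphon x r (b x - r)).
  rewrite triangle_density_strip// -subr_ge0.
  rewrite [leRHS](_ : _ = x * Q x); first by rewrite mulr_ge0// ltW.
  rewrite /Q /b; ring.
have := replica_symmetric_le RS gf Tf.
rewrite rate_functional_strip// rbK.
have t01 : 0 <= t <= 1 by rewrite !ltW.
have w0 : 0 <= (1 - x) ^+ 2 by exact: sqr_ge0.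
have := ler_wpM2l w0 (rate_tangent p01 bx01 t01).
have : x * S x < 0 by rewrite pmulr_rlt0.
have -> : t - b x = - (x * e) by rewrite /b; ring.
rewrite /S; move: (rate p r) (rate p t) (rate p (b x)) (rate_slope p (b x)).
move=> rr rt rb s; clear; lra.
Unshelve. all: by end_near.
Qed.

(** The case of equality e = (t^2 - r^2) / t of the previous bound, by a limit
from above. *)
Lemma replica_symmetric_parabola p t r : replica_symmetric R (p, t) -> t < 1 ->
  0 <= r <= 1 ->
  rate p t + rate_slope p t / (2 * t) * (r ^+ 2 - t ^+ 2) <= rate p r.
Proof.
move=> RS t1 r01.
have [[/= p01 /andP[pt _]] _ _] := RS.
have /andP[p0 p1] := p01.
have t0 : 0 < t := lt_le_trans p0 pt.
have s0 : 0 <= rate_slope p t by apply: rate_slope_ge0 => //; rewrite pt.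
suff : 0 <= 2 * (rate p r - rate p t) +
    rate_slope p t * ((t ^+ 2 - r ^+ 2) / t).
  have -> : rate_slope p t * ((t ^+ 2 - r ^+ 2) / t) =
      - 2 * (rate_slope p t / (2 * t) * (r ^+ 2 - t ^+ 2)).
    by field; rewrite gt_eqF.
  lra.
apply/ler_addgt0Pr => d d0.
have d'0 : 0 < d / (rate_slope p t + 1) by rewrite divr_gt0// ltr_pwDr.
apply: le_trans (strip_perturbation (e := (t ^+ 2 - r ^+ 2) / t +
    d / (rate_slope p t + 1)) RS t1 r01 _) _.
  by rewrite mulrDr mulrC divfK ?gt_eqF// ltrDl mulr_gt0.
have : rate_slope p t * (d / (rate_slope p t + 1)) <= d.
  by rewrite mulrA ler_pdivrMr ?ltr_pwDr// mulrC ler_pM2l// lerDl.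
lra.
Qed.

End TwoBlock.

(** * A symmetric double well at p = 1/10 *)

Section DoubleWell.
Context {R : realType}.
Implicit Types (u v a b : R).

Lemma mean_value (f df : R -> R) a b : a < b ->
  (forall x, a <= x <= b -> is_derive x 1 f (df x)) ->
  exists2 c, a < c < b & f b - f a = df c * (b - a).
Proof.
move=> ab fdf.
have [x xab|c|c cab fE] := @MVT R f df a b ab.
- by apply: fdf; move: xab; rewrite in_itv /= => /andP[/ltW -> /ltW ->].
- apply: derivable_within_continuous => x; rewrite in_itv /= => /fdf dfx.
  exact: ex_derive.
- by exists c => //; move: cab; rewrite in_itv.
Qed.

(** Half of the negative entropy, minus a parabola.  The coefficient ln 3 places
the two minima at 1/4 and 3/4. *)
Definition well u : R :=
  2^-1 * (u * ln u + (1 - u) * ln (1 - u)) - ln 3 * (u - 2^-1) ^+ 2.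

Definition well_slope u : R := 2^-1 * (ln u - ln (1 - u)) - ln 3 * (2 * u - 1).

Lemma is_derive_ln1B u : u < 1 ->
  is_derive u 1 (fun v => ln (1 - v)) (- (1 - u)^-1).
Proof.
move=> u1.
have d1 : is_derive u 1 (fun v : R => 1 - v) (- 1).
  by apply: is_derive_eq; rewrite add0r mul1r.
have d2 : is_derive (1 - u) 1 (@ln R) (1 - u)^-1.
  by apply: is_derive1_ln; rewrite subr_gt0.
have := is_derive1_comp (f := @ln R) (g := fun v => 1 - v).
by move=> /(_ _ _ _ d2 d1); rewrite mulrN1.
Qed.

Lemma is_derive_well u : 0 < u < 1 -> is_derive u 1 well (well_slope u).
Proof.
move=> /andP[u0 u1].
have d1 := is_derive1_ln u0.
have d2 := is_derive_ln1B u1.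
rewrite /well; apply: is_derive_eq.
rewrite /well_slope /GRing.scale /=.
field.
by apply/andP; split; lra.
Qed.

Lemma is_derive_well_slope u : 0 < u < 1 ->
  is_derive u 1 well_slope (2^-1 * (u * (1 - u))^-1 - 2 * ln 3).
Proof.
move=> /andP[u0 u1].
have d1 := is_derive1_ln u0.
have d2 := is_derive_ln1B u1.
rewrite /well_slope; apply: is_derive_eq.
rewrite /GRing.scale /=.
field.
by apply/andP; split; lra.
Qed.

Lemma well_slope_half : well_slope 2^-1 = 0.
Proof.
rewrite /well_slope.
have -> : 1 - 2^-1 = 2^-1 :> R by field.
by rewrite subrr mulfV// subrr !mulr0 subrr.
Qed.

Lemma well_slope_3_4 : well_slope (3 / 4) = 0.
Proof.
rewrite /well_slope.
have -> : 1 - 3 / 4 = 4^-1 :> R by field.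
by rewrite ln_div ?posrE// lnV ?posrE//; field.
Qed.

(** The slope vanishes at 1/2 and at 3/4 and is strictly convex on [1/2, 1[, so
it is negative between its two zeros and positive after the second one.  The
convexity is used through the mean value theorem on two adjacent intervals
and the monotonicity of the second derivative of [well]. *)
Lemma well_slope_sign u : 2^-1 < u < 1 ->
  (u < 3 / 4 -> well_slope u < 0) /\ (3 / 4 < u -> 0 < well_slope u).
Proof.
move=> /andP[u0 u1].
pose g x : R := 2^-1 * (x * (1 - x))^-1 - 2 * ln 3.
have g_incr c1 c2 : 2^-1 < c1 -> c1 < c2 -> c2 < 1 -> g c1 < g c2.
  move=> h1 h2 h3; rewrite /g ltrD2r ltr_pM2l ?invr_gt0//.
  rewrite ltf_pV2 ?posrE ?mulr_gt0 ?subr_gt0//; [|lra|lra|lra].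
  rewrite -subr_gt0.
  have -> : c1 * (1 - c1) - c2 * (1 - c2) = (c2 - c1) * (c1 + c2 - 1) by ring.
  by apply: mulr_gt0; lra.
have mv x y : 2^-1 <= x -> x < y -> y < 1 ->
    exists2 c, x < c < y & well_slope y - well_slope x = g c * (y - x).
  move=> hx xy y1; apply: mean_value => // z /andP[xz zy].
  by apply: is_derive_well_slope; apply/andP; split; lra.
have l34 : 2^-1 < 3 / 4 :> R by lra.
have l341 : 3 / 4 < 1 :> R by lra.
split=> hu; rewrite ltNge; apply/negP => neg.
  have [c1 /andP[h1 h2]] := mv _ _ (lexx _) u0 u1.
  have [c2 /andP[h3 h4]] := mv _ _ (ltW u0) hu l341.
  rewrite well_slope_half well_slope_3_4 subr0 sub0r => e2 e1.
  have c12 : c1 < c2 by lra.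
  have g1 : 0 <= g c1.
    by rewrite -(pmulr_lge0 (x := u - 2^-1)) ?subr_gt0// -e1.
  have g2 : g c2 <= 0.
    by rewrite -(pmulr_lle0 (x := 3 / 4 - u)) ?subr_gt0// -e2 oppr_le0.
  have c21 : c2 < 1 by lra.
  by have := g_incr _ _ h1 c12 c21; rewrite ltNge (le_trans g2 g1).
have [c1 /andP[h1 h2]] := mv _ _ (lexx _) l34 l341.
have [c2 /andP[h3 h4]] := mv _ _ (ltW l34) hu u1.
rewrite well_slope_half well_slope_3_4 !subr0 => e2 e1.
have c12 : c1 < c2 by lra.
have g1 : 0 <= g c1.
  by rewrite -(pmulr_lge0 (x := 3 / 4 - 2^-1)) ?subr_gt0// -e1.
have g2 : g c2 <= 0.
  by rewrite -(pmulr_lle0 (x := u - 3 / 4)) ?subr_gt0// -e2.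
have c21 : c2 < 1 by lra.
  by have := g_incr _ _ h1 c12 c21; rewrite ltNge (le_trans g2 g1).
Qed.

Lemma wellC u : well (1 - u) = well u.
Proof. by rewrite /well subKr; field. Qed.

(** These are 2^4 < 3^3 and 3^9 <= 2^16. *)
Lemma ln2_ln3 : 4 * ln 2 < 3 * ln 3 :> R /\ 9 * ln 3 <= 16 * ln 2 :> R.
Proof.
have l34 : ln (2 ^+ 4) < ln (3 ^+ 3) :> R.
  by rewrite ltr_ln ?posrE ?exprn_gt0//; lra.
have l916 : ln (3 ^+ 9) <= ln (2 ^+ 16) :> R.
  by rewrite ler_ln ?posrE ?exprn_gt0//; lra.
by rewrite !lnXn// in l34 l916; split; lra.
Qed.

Lemma well_3_4 : well (3 / 4) = 5 / 16 * ln 3 - ln 2.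
Proof.
rewrite /well.
have -> : 1 - 3 / 4 = 4^-1 :> R by field.
rewrite ln_div ?posrE// lnV ?posrE//.
have -> : ln 4 = 2 * ln 2 :> R.
  by rewrite (_ : 4 = 2 ^+ 2) ?lnXn ?mulr_natl//; ring.
by field.
Qed.

Lemma well_half : well 2^-1 = - (2^-1 * ln 2).
Proof.
rewrite /well.
have -> : 1 - 2^-1 = 2^-1 :> R by field.
by rewrite lnV ?posrE//; field.
Qed.

Lemma well_1 : well 1 = - (ln 3 / 4).
Proof. by rewrite /well subrr ln1 mulr0 mul0r; field. Qed.

Lemma well_min u : 2^-1 <= u <= 1 ->
  (u < 3 / 4 -> well (3 / 4) < well u) /\ well (3 / 4) <= well u.
Proof.
move=> /andP[u0 u1].
have lt_well : u < 3 / 4 -> well (3 / 4) < well u.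
  move=> hu.
  have [x /andP[xu x34]|c /andP[h1 h2] E] := @mean_value well well_slope _ _ hu.
    by apply: is_derive_well; apply/andP; split; lra.
  have c01 : 2^-1 < c < 1 by apply/andP; split; lra.
  have [/(_ h2) sl _] := well_slope_sign c01.
  by rewrite -subr_lt0 E nmulr_rlt0// subr_gt0.
split => //; have [hu|hu|->//] := ltgtP u (3 / 4).
  exact/ltW/lt_well.
move: u1; rewrite le_eqVlt => /predU1P[->|u1].
  by rewrite well_3_4 well_1; have [_] := ln2_ln3; lra.
have [x /andP[xu x34]|c /andP[h1 h2] E] := @mean_value well well_slope _ _ hu.
  by apply: is_derive_well; apply/andP; split; lra.
have c01 : 2^-1 < c < 1 by apply/andP; split; lra.
have [_ /(_ h1) sl] := well_slope_sign c01.
by rewrite -subr_ge0 E mulr_ge0 ?ltW// subr_gt0.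
Qed.

Lemma well_ge u : 0 <= u <= 1 -> well (3 / 4) <= well u.
Proof.
move=> /andP[u0 u1]; have [h|h] := leP 2^-1 u.
  by have /well_min[] : 2^-1 <= u <= 1 by rewrite h.
rewrite -(wellC u).
by have /well_min[] : 2^-1 <= 1 - u <= 1 by apply/andP; split; lra.
Qed.

Lemma well_gt u : 4^-1 < u < 3 / 4 -> well (3 / 4) < well u.
Proof.
move=> /andP[u0 u1]; have [h|h] := leP 2^-1 u.
  have /well_min[] : 2^-1 <= u <= 1 by apply/andP; split; lra.
  by move=> /(_ u1).
rewrite -(wellC u).
have /well_min[] : 2^-1 <= 1 - u <= 1 by apply/andP; split; lra.
by move=> h' _; apply: h'; lra.
Qed.

(** At p = 1/10 one has ln ((1 - p) / p) = 2 ln 3, so the linear term of the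
rate function is (ln 3) u; together with - (ln 3) u^2 it completes the square
- (ln 3) (u - 1/2)^2. *)
Lemma rate_well u : 0 <= u <= 1 ->
  rate 10^-1 u = well u + ln 3 * u ^+ 2 + (2^-1 * ln 10 - 3 / 4 * ln 3).
Proof.
move=> /andP[u0 u1].
have xlnx (x c : R) : 0 <= x -> 0 < c -> x * ln (x / c) = x * ln x - x * ln c.
  rewrite le_eqVlt => /predU1P[<- _|x0 c0]; first by rewrite !mul0r subrr.
  by rewrite ln_div ?posrE// mulrBr.
have q0 : 0 < 1 - 10^-1 :> R by lra.
rewrite /rate !xlnx ?subr_ge0 ?invr_gt0//.
have -> : 1 - 10^-1 = 3 ^+ 2 / 10 :> R by field.
by rewrite ln_div ?posrE ?exprn_gt0// lnV ?posrE// lnXn// /well; field.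
Qed.

End DoubleWell.

(** * The minorant region *)

Section Main.
Context {R : realType}.

Lemma replica_symmetric_minorant : replica_symmetric R `<=` minorant_region R.
Proof.
move=> [p t] RS; have [prm _ _] := RS; split => //.
move: prm => [/= p01 /andP[pt]]; have /andP[p0 p1] := p01.
have t0 : 0 < t := lt_le_trans p0 pt.
rewrite le_eqVlt => /predU1P[t1|t1].
  have one01 : (0 : R) <= (1 : R) <= 1 by rewrite lexx ler01.
  (* At an endpoint any alpha works. *)
  exists 1; first by rewrite ltr01 lexx.
  apply: (minorant_condition_touch (k0 := fun x => if x == 1 then phi p 1 else 0)).
  - exact: ltr01.
  - by rewrite t1.
  - by apply: convex_endpoint; exact: phi_ge0.
  - move=> u u01; case: ifPn => [/eqP u1|_]; last exact: phi_ge0.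
    have : u `^ (3 * 1) == 1 by apply/eqP.
    rewrite powR_eq1 mulr1 pnatr_eq0 orbF ltNge.
    by case/andP: u01 => -> _; rewrite orbF => /eqP ->.
  - by rewrite t1 powR1 eqxx.
have t01 : 0 <= t <= 1 by rewrite !ltW.
pose m := rate_slope p t / (2 * t).
have m0 : 0 <= m.
  apply: divr_ge0; last by rewrite mulr_ge0// ltW.
  by apply: rate_slope_ge0 => //; rewrite pt.
have line (u : R) : 0 <= u <= 1 -> rate p t - m * t ^+ 2 + m * u ^+ 2 <= phi p u.
  apply: phi_ge_parabola => // r r01.
  by have := replica_symmetric_parabola RS t1 r01; rewrite -/m; lra.
have sq (u : R) : 0 <= u -> u `^ (3 * (2 / 3)) = u ^+ 2.
  by move=> u0; rewrite mulrC divfK// powR_mulrn.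
exists (2 / 3); first by apply/andP; split; lra.
apply: (minorant_condition_touch (k0 := fun x => rate p t - m * t ^+ 2 + m * x)).
- by lra.
- by [].
- exact: convex_affine.
- by move=> u u01; rewrite sq; [exact: line|case/andP: u01].
- rewrite sq ?(ltW t0)// subrK; apply/eqP; rewrite eq_le phi_le_rate// andbT.
  by have := line t t01; rewrite subrK.
Qed.

Lemma replica_breaking_minorant : exists2 t : R,
  replica_breaking R (10^-1, t) & minorant_region R (10^-1, t).
Proof.
have p01 : 0 < (10^-1 : R) < 1 by apply/andP; split; lra.
pose L : R := well (3 / 4) + (2^-1 * ln 10 - 3 / 4 * ln 3).
have l30 : 0 < ln 3 :> R by apply: ln_gt0; lra.
have parabola (u : R) : 0 <= u <= 1 -> L + ln 3 * u ^+ 2 <= phi 10^-1 u.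
  apply: phi_ge_parabola => //; first exact: ltW.
  by move=> r r01; rewrite rate_well//; have := well_ge r01; rewrite /L; lra.
pose psi (u : R) := phi 10^-1 u - ln 3 * u.
have psi_cont : {within `[4^-1, 3 / 4], continuous psi}.
  apply: continuous_in_subspaceT => u; rewrite inE /= in_itv /= => /andP[u0 u1].
  apply: cvgB; last by apply: cvgM; [exact: cvg_cst|exact: cvg_id].
  by apply: phi_continuous => //; apply/andP; split; lra.
have h14 : 4^-1 <= 3 / 4 :> R by lra.
have [t] := EVT_min h14 psi_cont; rewrite in_itv /= => /andP[t14 t34] t_min.
have half01 : 0 <= (2^-1 : R) <= 1 by apply/andP; split; lra.
(* The chord of the parabola between 1/4 and 3/4 is (L - 3/16 ln 3) + (ln 3) u. *)
have psit : psi t < L - 3 / 16 * ln 3.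
  apply: (@le_lt_trans _ _ (psi 2^-1)).
    by apply: t_min; rewrite in_itv /=; apply/andP; split; lra.
  have := phi_le_rate p01 half01; rewrite rate_well// well_half.
  rewrite /psi /L well_3_4; have [] := @ln2_ln3 R; lra.
have below (u : R) : 0 <= u <= 1 -> ~ (4^-1 < u < 3 / 4) ->
    L - 3 / 16 * ln 3 <= psi u.
  move=> u01 out; have := parabola u u01.
  have : 0 <= (u - 4^-1) * (u - 3 / 4).
    have [h|h] := leP u 4^-1.
      by rewrite mulr_le0//; lra.
    apply: mulr_ge0; first lra.
    by rewrite subr_ge0 leNgt; apply/negP => h'; apply: out; rewrite h.
  move=> /(mulr_ge0 (ltW l30)).
  rewrite /psi; lra.
have t01 : 0 <= t <= 1 by apply/andP; split; lra.
have t_in : 4^-1 < t < 3 / 4.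
  by apply: contrapT => /(below t t01); rewrite leNgt psit.
have prm : parameters R (10^-1, t).
  by split => //=; apply/andP; split; lra.
exists t.
  split => // RS.
  have t1 : t < 1 by case/andP: t_in => _; lra.
  have t0 : 0 < t by lra.
  have r1 : 0 <= (4^-1 : R) <= 1 by apply/andP; split; lra.
  have r2 : 0 <= (3 / 4 : R) <= 1 by apply/andP; split; lra.
  have := replica_symmetric_parabola RS t1 r1.
  have := replica_symmetric_parabola RS t1 r2.
  pose m := rate_slope 10^-1 t / (2 * t); rewrite -/m !rate_well//.
  have -> : well 4^-1 = well (3 / 4) :> R.
    by rewrite -wellC; congr well; field.
  have := well_gt t_in; move: (well _) (well _) => wt w0 wlt h2 h1.
  case/andP: t_in => ht1 ht2.
  have q1 : 0 < (t ^+ 2 - 4^-1 ^+ 2).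
    by rewrite subr_gt0 ltr_pXn2r// nnegrE; lra.
  have q2 : 0 < ((3 / 4) ^+ 2 - t ^+ 2).
    by rewrite subr_gt0 ltr_pXn2r// nnegrE; lra.
  (* The parabola attached to t has coefficient m.  If m <= ln 3 it violates the
     bound at 1/4, otherwise at 3/4. *)
  have [hm|hm] := leP m (ln 3).
    have hm' : 0 <= ln 3 - m by rewrite subr_ge0.
    by have := mulr_ge0 hm' (ltW q1); lra.
  have hm' : 0 <= m - ln 3 by rewrite subr_ge0 ltW.
  by have := mulr_ge0 hm' (ltW q2); lra.
split => //; exists 3^-1; first by apply/andP; split; lra.
have id1 (u : R) : 0 <= u -> u `^ (3 * 3^-1) = u.
  by move=> u0; rewrite mulfV// powRr1.
apply: (minorant_condition_touch (k0 := fun x => psi t + ln 3 * x)) => //.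
- exact: convex_affine.
- move=> u u01; rewrite id1; last by case/andP: u01.
  suff : psi t <= psi u by rewrite /psi; lra.
  have [u_in|u_out] := pselect (4^-1 < u < 3 / 4).
    by apply: t_min; rewrite in_itv /=; case/andP: u_in => /ltW -> /ltW ->.
  exact: ltW (lt_le_trans psit (below u u01 u_out)).
- by rewrite id1 ?subrK//; lra.
Qed.

End Main.

Theorem lemma4p2 (R : realType) :
  replica_symmetric R `<=` minorant_region R /\
  exists S : set (R * R),
    [/\ S !=set0, S `<=` replica_breaking R & S `<=` minorant_region R].
Proof.
split; first exact: replica_symmetric_minorant.
have [t tRB tM] := @replica_breaking_minorant R.
exists [set (10^-1, t)]; split; first by exists (10^-1, t).
- by move=> _ ->.
- by move=> _ ->.
Qed.
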